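(* Let $t_1, t_2, t_3, \ldots$ be a countably infinite set of commuting indeterminates. Then, as formal power series, \[ \prod_{k=1}^\infty \frac{1}{1-\left(t_1^k+t_2^k+t_3^k+\cdots\right)} \;=\; \sum_{\lambda}\sum_{\boldsymbol{\mu}} \left(c^{\lambda}_{\boldsymbol{\mu}}\right)^2 \,\boldsymbol{t}^{\boldsymbol{\mu}}, \] where the outer sum is over all partitions $\lambda$ (with non-negative integer parts), the inner sum is over all finitely supported sequences of partitions $\boldsymbol{\mu}=(\mu^{(1)},\mu^{(2)},\mu^{(3)},\ldots)$ (all but finitely many $\mu^{(j)}$ empty), and $\boldsymbol{t}^{\boldsymbol{\mu}} = t_1^{|\mu^{(1)}|}t_2^{|\mu^{(2)}|}t_3^{|\mu^{(3)}|}\cdots$.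
   Context: For a partition $\nu$, $|\nu|$ denotes the sum of its parts. For a finite (or finitely supported) sequence of partitions $\boldsymbol{\mu}=(\mu^{(1)},\ldots,\mu^{(m)})$, the generalized Littlewood–Richardson coefficient $c^{\lambda}_{\boldsymbol{\mu}}$ is the multiplicity of the irreducible polynomial representation $F^{\lambda}_n$ of $\mathrm{GL}_n(\mathbb{C})$ with highest weight $\lambda$ in the tensor product $F^{\mu^{(1)}}_n\otimes\cdots\otimes F^{\mu^{(m)}}_n$ under the diagonal action, for $n$ sufficiently large; equivalently, it is defined by the expansion of products of Schur functions $s_{\mu^{(1)}}\cdots s_{\mu^{(m)}}=\sum_\lambda c^{\lambda}_{\boldsymbol{\mu}}\, s_\lambda$. In particular $c^{\lambda}_{\boldsymbol{\mu}}=0$ unless $|\lambda|=\sum_j|\mu^{(j)}|$. *)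

(* Defs.v *)
From mathcomp Require Import all_boot all_algebra.
From mathcomp Require Import mpoly.
From Stdlib Require Import ClassicalEpsilon.

Set Implicit Arguments.
Unset Strict Implicit.
Unset Printing Implicit Defensive.

Import GRing.Theory.

Definition is_partition (l : seq nat) : bool :=
  sorted geq l && all (fun x => 0 < x) l.

(* The (finite) list of all partitions of k.  Every partition of k has at
   most k parts, each at most k, so it is obtained from some function
   'I_k -> 'I_k.+1 by dropping zero entries. *)
Definition partitions_of (k : nat) : seq (seq nat) :=
  undup [seq l <- [seq filter (fun x => 0 < x) [seq nat_of_ord (f i) | i <- enum 'I_k]
                  | f : {ffun 'I_k -> 'I_k.+1}]
        | is_partition l && (sumn l == k)].

(* Semistandard Young tableaux of shape lam (with at most N rows, all rows
   of length at most D) and entries in 'I_N.  A tableau is a map on the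
   cells (i, j) (row i, column j) of the N x D box, with value None exactly
   outside the Young diagram of lam; rows weakly increase, columns strictly
   increase. *)
Definition is_ssyt (N D : nat) (lam : seq nat)
    (T : {ffun 'I_N * 'I_D -> option 'I_N}) : bool :=
  [forall c : 'I_N * 'I_D, (T c == None) == (nth 0 lam c.1 <= c.2)] &&
  [forall c : 'I_N * 'I_D, forall c' : 'I_N * 'I_D,
     ((c.1 == c'.1) && (c.2.+1 == c'.2)) ==>
     (match T c, T c' with Some a, Some b => (a <= b)%N | _, _ => true end)] &&
  [forall c : 'I_N * 'I_D, forall c' : 'I_N * 'I_D,
     ((c.1.+1 == c'.1) && (c.2 == c'.2)) ==>
     (match T c, T c' with Some a, Some b => (a < b)%N | _, _ => true end)].

(* The Schur polynomial s_lam(x_0, ..., x_{N-1}) (combinatorial definition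
   as the generating function of SSYT); meaningful when size lam <= N. *)
Definition schur (N : nat) (lam : seq nat) : {mpoly int[N]} :=
  \sum_(T : {ffun 'I_N * 'I_(sumn lam) -> option 'I_N} | is_ssyt lam T)
    \prod_(c : 'I_N * 'I_(sumn lam)) (if T c is Some a then 'X_a else 1)%R.

(* c is an expansion of s_{mu_1} ... s_{mu_m} in the Schur basis, computed
   in d = sum_j |mu_j| variables (enough variables: every partition lam of
   size d has at most d parts). *)
Definition LR_expansion (mus : seq (seq nat)) (c : seq nat -> int) : Prop :=
  let d := sumn [seq sumn m | m <- mus] in
  (\prod_(m <- mus) schur d m = \sum_(lam <- partitions_of d) c lam *: schur d lam)%R.

(* Generalized Littlewood-Richardson coefficient c^lam_mus: the coefficient
   of s_lam in the (unique) Schur expansion above; 0 unless |lam| equals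
   sum_j |mu_j|. *)
Definition LRcoef (lam : seq nat) (mus : seq (seq nat)) : int :=
  if sumn lam == sumn [seq sumn m | m <- mus]
  then epsilon (inhabits (fun _ : seq nat => 0%R)) (LR_expansion mus) lam
  else 0%R.

Fixpoint partition_seqs (ks : seq nat) : seq (seq (seq nat)) :=
  match ks with
  | [::] => [:: [::]]
  | k :: ks' => [seq p :: r | p <- partitions_of k, r <- partition_seqs ks']
  end.

Definition psum (n k : nat) : {mpoly int[n]} := (\sum_(i < n) 'X_i ^+ k)%R.

(* Truncation of prod_{k>=1} 1/(1 - p_k) in n variables which is exact in
   all degrees <= d (since p_k has no constant term and degree k). *)
Definition lhs_trunc (n d : nat) : {mpoly int[n]} :=
  (\prod_(1 <= k < d.+1) \sum_(0 <= j < d.+1) psum n k ^+ j)%R.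

(* Main.v *)
(* In terms of the Hall inner product the right-hand side is the sum over mu of
   <s_mu, s_mu>, where s_mu is the product of the s_(mu_j).  The coefficient of
   t^m in the Cauchy identity
     \sum_mu s_mu(x) s_mu(y) t^|mu| = \sum_rho p_rho(x) p_rho(y) p_rho(t) / z_rho,
   a product of one Cauchy kernel per variable t_j, gives the matrix of the
   form \sum_mu s_mu(x) s_mu(y) in the Schur basis; its trace is found by
   passing to the power sums, which are orthogonal with norms z_rho, and equals
   the coefficient of t^m in \sum_rho p_rho(t), the left-hand side.

   The Cauchy identity comes from Pieri's rule, proved by induction on the
   number of variables from a local bijection on partitions, and from Newton's
   identities, which turn complete symmetric functions into power sums.
   Pieri's rule also makes products of Schur functions and of power sums
   integral combinations of Schur functions, so that the symmetry of s_lam is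
   never needed. *)
Require Import Defs.
From mathcomp Require Import all_boot all_algebra.
From mathcomp Require Import mpoly.
From mathcomp Require Import zify.
From Stdlib Require Import ClassicalEpsilon.

Set Implicit Arguments.
Unset Strict Implicit.
Unset Printing Implicit Defensive.

Import GRing.Theory Num.Theory.

(** * Partitions and horizontal strips *)

(** Let $d = |m|$, let $B$ be the matrix of integer coordinates of the $p_\rho$ with $|\rho| = d$ in
    the Schur basis, $Z$ the diagonal matrix of the $1/z_\rho$ and $U$ that of the coefficients of
    $t^m$ in $p_\rho(t)$. The two comparisons of kernels read $B^T Z B = 1$ and $(\sum_\mu
    c^\lambda_\mu c^{\lambda'}_\mu)_{\lambda,\lambda'} = B^T Z U B$. The trace of the latter is that
    of $U$ once $B B^T Z = 1$, which requires $B$ to be square; hence the count of multiplicity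
    functions against partitions. Two features of the statement shape the rest. Its coefficients
    come from a choice operator, so an integral expansion has to be shown to exist before they mean
    anything, and it must then be carried from integer polynomials in $d$ variables to other
    alphabets. Its Schur polynomials are sums over tableaux; they are replaced by [sch], a recursion
    on the variables that makes sense in every commutative ring. *)

Lemma is_partition_cons a l :
  is_partition (a :: l) = [&& 0 < a, nth 0 l 0 <= a & is_partition l].
Proof.
by rewrite /is_partition; case: l => [|b l] //=; rewrite ?andbT //; lia.
Qed.

Lemma partition_nth_anti l i j :
  is_partition l -> i <= j -> nth 0 l j <= nth 0 l i.
Proof.
elim: l i j => [|a l IH] i j; first by rewrite !nth_nil.
rewrite is_partition_cons => /and3P[_ la pl].
case: i j => [|i] [|j] //= ij; last exact: IH.
by apply: leq_trans la; apply: IH.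
Qed.

Lemma partition_nth_gt0 l i : is_partition l -> (0 < nth 0 l i) = (i < size l).
Proof.
move=> /andP[_ /allP pos]; case: (ltnP i (size l)) => [il|il]; last by rewrite nth_default.
by rewrite pos // mem_nth.
Qed.

Lemma partition_nth_inj l l' : is_partition l -> is_partition l' ->
  nth 0 l =1 nth 0 l' -> l = l'.
Proof.
move=> pl pl' eqn; apply: (@eq_from_nth _ 0) => // .
apply/eqP; rewrite eqn_leq; apply/andP; split; rewrite leqNgt -partition_nth_gt0 //.
  by rewrite eqn nth_default.
by rewrite -eqn nth_default.
Qed.

Lemma size_partition_le l : is_partition l -> size l <= sumn l.
Proof.
elim: l => //= a l IH; rewrite is_partition_cons => /and3P[a0 _ /IH]; lia.
Qed.

Lemma nth_partition_le_sumn (l : seq nat) i : nth 0 l i <= sumn l.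
Proof. by elim: l i => [|a l IH] [|i] //=; [lia | have := IH i; lia]. Qed.

Lemma sumn_nth (l : seq nat) L :
  size l <= L -> sumn l = \sum_(i < L) nth 0 l i.
Proof.
elim: l L => [|a l IH] [|L] //= sL; rewrite ?big_ord0 //.
  by rewrite big1 // => i _; rewrite nth_nil.
by rewrite big_ord_recl /= (IH L).
Qed.

Lemma mem_partitions_of l k :
  (l \in partitions_of k) = is_partition l && (sumn l == k).
Proof.
rewrite /partitions_of mem_undup mem_filter.
apply/idP/idP => [/andP[]//|/andP[pl /eqP sl]]; rewrite pl sl eqxx /=.
have szl : size l <= k by rewrite -sl size_partition_le.
(* [nth] pads [l] with zeros up to [k] entries; [filter] removes them again. *)
apply/mapP; exists [ffun i : 'I_k => inord (nth 0 l i)]; first by rewrite mem_enum.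
have -> : [seq nat_of_ord ([ffun i : 'I_k => inord (nth 0 l i)] i : 'I_k.+1) | i <- enum 'I_k]
  = mkseq (nth 0 l) k.
  rewrite /mkseq -val_enum_ord -map_comp; apply: eq_map => i /=.
  by rewrite ffunE inordK // ltnS -[X in _ <= X]sl nth_partition_le_sumn.
have -> : mkseq (nth 0 l) k = l ++ nseq (k - size l) 0.
  apply: (@eq_from_nth _ 0); rewrite size_mkseq ?size_cat ?size_nseq ?subnKC //.
  by move=> i ik; rewrite nth_mkseq // nth_cat nth_nseq; case: ltnP => // li;
    rewrite nth_default //; case: ifP.
rewrite filter_cat (_ : filter _ (nseq _ _) = [::]) ?cats0.
  by apply/esym/all_filterP; case/andP: pl.
by elim: (k - _).
Qed.

Lemma partitions_of_uniq k : uniq (partitions_of k).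
Proof. exact: undup_uniq. Qed.

Lemma partitions_ofP l k :
  reflect (is_partition l /\ sumn l = k) (l \in partitions_of k).
Proof.
by rewrite mem_partitions_of; apply: (iffP andP) => -[? /eqP].
Qed.

Definition parts_upto e := flatten [seq partitions_of k | k <- iota 0 e.+1].

Lemma mem_parts_upto l e : (l \in parts_upto e) = is_partition l && (sumn l <= e).
Proof.
apply/flatten_mapP/andP => [[k]|[pl se]].
  by rewrite mem_iota => ke /partitions_ofP[pl ->].
by exists (sumn l); rewrite ?mem_iota // mem_partitions_of pl eqxx.
Qed.

Lemma parts_upto_uniq e : uniq (parts_upto e).
Proof.
rewrite /parts_upto; elim: (iota _ _) (iota_uniq 0 e.+1) => //= a s IH /andP[as_ us].
rewrite cat_uniq partitions_of_uniq IH // andbT /=; apply/hasPn => l /flatten_mapP[k ks].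
move=> /partitions_ofP[_ lk]; apply/negP => /partitions_ofP[_ la].
by move: as_; rewrite -la lk ks.
Qed.

Lemma big_parts_upto (R : nmodType) e (P : pred (seq nat)) (F : seq nat -> R) :
  (\sum_(l <- parts_upto e | P l) F l =
   \sum_(k < e.+1) \sum_(l <- partitions_of k | P l) F l)%R.
Proof. by rewrite big_flatten big_map -[iota _ _]/(index_iota 0 e.+1) big_mkord. Qed.

Lemma big_partitions_of_size (R : nmodType) k (P : pred (seq nat))
    (F : nat -> seq nat -> R) :
  (\sum_(l <- partitions_of k | P l) F (sumn l) l =
   \sum_(l <- partitions_of k | P l) F k l)%R.
Proof.
rewrite big_seq_cond [RHS]big_seq_cond; apply: eq_bigr => l.
by case/andP => /partitions_ofP[_ ->].
Qed.

(** Cuts [f] at its first zero; for a weakly decreasing [f] with [f L = 0] nothing is lost, so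
    partitions can be built row by row from a formula. *)
Fixpoint mkpart L (f : nat -> nat) : seq nat :=
  if L is L'.+1 then
    if f 0 == 0 then [::] else f 0 :: mkpart L' (f \o succn)
  else [::].

Lemma nth_mkpart L f : (forall i, f i.+1 <= f i) -> f L = 0 ->
  nth 0 (mkpart L f) =1 f.
Proof.
move=> anti; have anti0 i j : i <= j -> f j <= f i.
  by move/subnK <-; elim: (j - i) => // k IH; apply: leq_trans IH; apply: anti.
elim: L f anti anti0 => [|L IH] f anti anti0 fL i /=.
  by rewrite nth_nil; apply/esym/eqP; rewrite -leqn0 -fL anti0.
case: eqP => f0; first by rewrite nth_nil; apply/esym/eqP; rewrite -leqn0 -f0 anti0.
by case: i => //= i; rewrite IH // => [k|k k' kk'] /=; [apply: anti|apply: anti0].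
Qed.

Lemma mkpart_partition L f : (forall i, f i.+1 <= f i) -> f L = 0 ->
  is_partition (mkpart L f).
Proof.
elim: L f => //= L IH f anti fL; case: eqP => // /eqP f0.
have anti' i : (f \o succn) i.+1 <= (f \o succn) i by apply: anti.
by rewrite is_partition_cons nth_mkpart // lt0n f0 anti IH.
Qed.

Lemma sumn_mkpart L f : (forall i, f i.+1 <= f i) -> f L = 0 ->
  sumn (mkpart L f) = \sum_(i < L) f i.
Proof.
elim: L f => [|L IH] f anti fL /=; first by rewrite big_ord0.
have n0 : forall i, f i <= f 0.
  by elim=> // k kle; apply: leq_trans kle; apply: anti.
case: eqP => f0; last by rewrite big_ord_recl /= IH // => i; apply: anti.
by rewrite big1 // => i _; apply/eqP; rewrite -leqn0 -f0.
Qed.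

(* lam / mu is a horizontal strip. *)
Definition inter (mu lam : seq nat) : bool :=
  all (fun i => nth 0 lam i.+1 <= nth 0 mu i <= nth 0 lam i)
      (iota 0 (maxn (size mu) (size lam))).

Lemma interP mu lam :
  reflect (forall i, nth 0 lam i.+1 <= nth 0 mu i <= nth 0 lam i) (inter mu lam).
Proof.
apply: (iffP allP) => H i; last by move=> _; apply: H.
case: (ltnP i (maxn (size mu) (size lam))) => il; first by apply: H; rewrite mem_iota.
by rewrite ![nth 0 _ _]nth_default //; lia.
Qed.

Lemma inter_sumn mu lam : inter mu lam -> sumn mu <= sumn lam.
Proof.
move/interP => H; rewrite (@sumn_nth mu (maxn (size mu) (size lam))) ?leq_maxl //.
rewrite (@sumn_nth lam (maxn (size mu) (size lam))) ?leq_maxr //.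
by apply: leq_sum => i _; case/andP: (H i).
Qed.

Lemma inter_size mu lam : is_partition mu -> inter mu lam -> size mu <= size lam.
Proof.
move=> pm /interP H; rewrite leqNgt -partition_nth_gt0 //.
by have := H (size lam); rewrite (nth_default 0 (leqnn (size lam))); lia.
Qed.

Lemma inter_size_le mu lam : is_partition lam -> inter mu lam ->
  size lam <= (size mu).+1.
Proof.
move=> pl /interP H; rewrite leqNgt -partition_nth_gt0 //.
by have := H (size mu); rewrite (nth_default 0 (leqnn (size mu))); lia.
Qed.

Lemma size_can_eq (T : eqType) (f g : T -> T) (A B : seq T) :
  uniq A -> uniq B -> {in A, forall x, f x \in B} -> {in B, forall x, g x \in A} ->
  {in A, cancel f g} -> {in B, cancel g f} -> size A = size B.
Proof.
have le h h' (C D : seq T) : uniq C -> {in C, forall x, h x \in D} ->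
    {in C, cancel h h'} -> size C <= size D.
  move=> uC hC hK; rewrite -(size_map h C); apply: uniq_leq_size.
    by rewrite map_inj_in_uniq //; apply: can_in_inj hK.
  by move=> _ /mapP[x xC ->]; apply: hC.
move=> uA uB fA gB fK gK; apply/eqP; rewrite eqn_leq.
by rewrite (le f g) //= (le g f).
Qed.

(* Fomin's local growth rule.  The constraints on kappa say that kappa_i lies in
   [max(lam_(i+1), mu_(i+1)), min(lam_i, mu_i)], and those on nu that nu_(i+1)
   lies in the same interval; the bijection reflects this interval, and nu_0
   is determined by the size of nu. *)
Section LocalRule.
Variables (lam mu : seq nat) (e : nat).
Hypotheses (plam : is_partition lam) (pmu : is_partition mu).

Let mx i := maxn (nth 0 lam i) (nth 0 mu i).
Let mn i := minn (nth 0 lam i) (nth 0 mu i).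
Let L := maxn (size lam) (size mu).

Let flip_fun (k : seq nat) i := mx i.+1 + mn i - nth 0 k i.
Let up_fun (k : seq nat) i :=
  if i is i'.+1 then flip_fun k i' else mx 0 + (sumn k + e - (sumn lam + sumn mu)).
Let down_fun (n : seq nat) i := flip_fun (behead n) i.

Let mxL i : L <= i -> mx i = 0.
Proof. by rewrite /mx /L => Li; rewrite !nth_default //; lia. Qed.
Let mnL i : L <= i -> mn i = 0.
Proof. by rewrite /mn /L => Li; rewrite !nth_default //; lia. Qed.

Let sum_mxmn : \sum_(i < L.+1) mx i + \sum_(i < L.+1) mn i = sumn lam + sumn mu.
Proof.
rewrite (@sumn_nth lam L.+1) ?(@sumn_nth mu L.+1) -?big_split /=.
- by apply: eq_bigr => i _; rewrite /mx /mn; lia.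
- by rewrite /L; lia.
by rewrite /L; lia.
Qed.

Let below := [seq k <- parts_upto (sumn mu) |
  [&& inter k lam, inter k mu & sumn lam + sumn mu <= sumn k + e]].
Let above := [seq n <- partitions_of e | inter lam n && inter mu n].

Let belowP k : reflect
  [/\ is_partition k, forall i, mx i.+1 <= nth 0 k i <= mn i
    & sumn lam + sumn mu <= sumn k + e] (k \in below).
Proof.
rewrite mem_filter mem_parts_upto.
apply: (iffP idP) => [/andP[/and3P[/interP il /interP im ->]] /andP[-> _]|[-> H ->]].
  by split=> // i; have := il i; have := im i; rewrite /mx /mn; lia.
have im : inter k mu by apply/interP => i; have := H i; rewrite /mx /mn; lia.
have -> : inter k lam by apply/interP => i; have := H i; rewrite /mx /mn; lia.
by rewrite im (inter_sumn im).
Qed.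

Let aboveP n : reflect
  [/\ is_partition n, forall i, mx i.+1 <= nth 0 n i.+1 <= mn i,
     mx 0 <= nth 0 n 0 & sumn n = e] (n \in above).
Proof.
rewrite mem_filter mem_partitions_of.
apply: (iffP idP) => [/andP[/andP[/interP il /interP im]] /andP[-> /eqP ->]|[-> H H0 ->]].
  split=> // [i|]; last by have := il 0; have := im 0; rewrite /mx; lia.
  by have := il i; have := im i; have := il i.+1; have := im i.+1; rewrite /mx /mn; lia.
rewrite eqxx !andbT; move: H H0; rewrite /mx /mn => H H0.
apply/andP; split; apply/interP => -[|i].
- by have := H 0; lia.
- by have := H i.+1; have := H i; lia.
- by have := H 0; lia.
by have := H i.+1; have := H i; lia.
Qed.

Let flipE s : (forall i, mx i.+1 <= nth 0 s i <= mn i) ->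
  forall i, mx i.+1 <= flip_fun s i <= mn i.
Proof. by move=> H i; have := H i; rewrite /flip_fun /mx /mn; lia. Qed.

Let mnmx i : mn i <= mx i. Proof. rewrite /mn /mx; lia. Qed.

Let down_anti s : (forall i, mx i.+1 <= nth 0 s i <= mn i) ->
  forall i, flip_fun s i.+1 <= flip_fun s i.
Proof. by move=> H i; have := flipE H i; have := flipE H i.+1; have := mnmx i.+1; lia. Qed.

Let up_anti k : k \in below -> forall i, up_fun k i.+1 <= up_fun k i.
Proof.
case/belowP=> pk H _ [|i] /=; last exact: down_anti.
by have := flipE H 0; have := mnmx 0; lia.
Qed.

Let flipL s i : L <= i -> flip_fun s i = 0.
Proof. by move=> Li; rewrite /flip_fun mxL ?mnL //; lia. Qed.

Let up k := mkpart L.+2 (up_fun k).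
Let down n := mkpart L.+1 (down_fun n).

Let size_belowL k : k \in below -> size k <= L.
Proof.
case/belowP=> pk H _; rewrite leqNgt -partition_nth_gt0 //.
by have := H L; rewrite mnL //; lia.
Qed.

(** The endpoints of all the intervals are the row maxima and minima of [lam] and [mu], except the
    maximum of row 0; a number and its reflection add up to the two endpoints. *)
Let sum_flip s : (forall i, mx i.+1 <= nth 0 s i <= mn i) -> size s <= L.+1 ->
  mx 0 + \sum_(i < L.+1) flip_fun s i + sumn s = sumn lam + sumn mu.
Proof.
move=> H sL; rewrite (sumn_nth sL) -addnA -big_split /= -sum_mxmn.
rewrite (eq_bigr (fun i : 'I_L.+1 => mx i.+1 + mn i)).
  rewrite big_split /= addnA; congr (_ + _).
  by rewrite big_ord_recr /= (mxL (leqnSn L)) addn0 big_ord_recl.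
by move=> i _; have := H i; rewrite /flip_fun; lia.
Qed.

Let upP k : k \in below -> up k \in above.
Proof.
move=> kb; have /belowP[pk H se] := kb.
have anti := up_anti kb; have upL : up_fun k L.+2 = 0 by rewrite /= flipL.
apply/aboveP; split; first exact: mkpart_partition.
- by move=> i; rewrite nth_mkpart // flipE.
- by rewrite nth_mkpart //= leq_addr.
rewrite sumn_mkpart // big_ord_recl /=.
have := sum_flip H (leqW (size_belowL kb)).
by move: (\sum_(i < L.+1) _) => S; lia.
Qed.

Let behead_above n : n \in above ->
  [/\ is_partition (behead n), forall i, mx i.+1 <= nth 0 (behead n) i <= mn i,
     size (behead n) <= L & e = nth 0 n 0 + sumn (behead n)].
Proof.
case/aboveP=> pn H H0 <-; have H' i : mx i.+1 <= nth 0 (behead n) i <= mn i.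
  by rewrite nth_behead.
have pb : is_partition (behead n).
  by move: pn; case: (n) => // a l; rewrite is_partition_cons => /and3P[].
split=> //; last by case: (n).
by rewrite leqNgt -partition_nth_gt0 //; have := H' L; rewrite mnL //; lia.
Qed.

Let downP n : n \in above -> down n \in below.
Proof.
move=> na; have [pb H sL eE] := behead_above na; have /aboveP[_ _ H0 _] := na.
have anti := down_anti H; have dL : down_fun n L.+1 = 0 by rewrite /down_fun flipL.
apply/belowP; split; first exact: mkpart_partition.
  by move=> i; rewrite nth_mkpart // flipE.
rewrite sumn_mkpart //; have := sum_flip H (leqW sL); rewrite -/(down_fun n).
by rewrite /down_fun; move: (\sum_(i < L.+1) _) => S; lia.
Qed.

Let nth_up k : k \in below -> nth 0 (up k) =1 up_fun k.
Proof. by move=> kb; apply: nth_mkpart; [exact: up_anti | rewrite /= flipL]. Qed.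

Let nth_down n : n \in above -> nth 0 (down n) =1 down_fun n.
Proof.
move=> na; have [_ H _ _] := behead_above na.
by apply: nth_mkpart; [exact: down_anti | rewrite /down_fun flipL].
Qed.

Let upK : {in below, cancel up down}.
Proof.
move=> k kb; have na := upP kb; have /belowP[pd _ _] := downP na.
have /belowP[pk H _] := kb; apply: partition_nth_inj => // i.
rewrite nth_down // /down_fun {1}/flip_fun nth_behead nth_up //= /flip_fun.
by have := H i; lia.
Qed.

Let downK : {in above, cancel down up}.
Proof.
move=> n na; have kb := downP na; have /aboveP[pn H H0 _] := na.
have /aboveP[pu _ _ _] := upP kb; have [pb H' sL eE] := behead_above na.
apply: partition_nth_inj => // i; rewrite nth_up //; case: i => [|i] /=; last first.
  rewrite /flip_fun nth_down // /down_fun /flip_fun nth_behead.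
  by have := H i; lia.
have := sum_flip H' (leqW sL); rewrite sumn_mkpart; last 2 first.
- exact: down_anti.
- by rewrite /down_fun flipL.
by rewrite /down_fun; move: (\sum_(i < L.+1) _) => S; lia.
Qed.

(** The inequality on sizes says that $\nu_0$, computed from $|\nu| = e$, is at least
    $\max(\lambda_0, \mu_0)$; it also makes the truncated subtraction in [up_fun] exact. *)
Lemma local_rule :
  count (fun n => inter lam n && inter mu n) (partitions_of e) =
  count (fun k => [&& inter k lam, inter k mu & sumn lam + sumn mu <= sumn k + e])
        (parts_upto (sumn mu)).
Proof.
rewrite -!size_filter; apply/esym.
apply: (size_can_eq (f := up) (g := down)) => //; apply: filter_uniq.
  exact: parts_upto_uniq.
exact: partitions_of_uniq.
Qed.

End LocalRule.

(** * Pieri's rule *)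

Local Open Scope ring_scope.

Lemma sumr_const_count (V : nmodType) (I : Type) (r : seq I) (P : pred I) (c : V) :
  \sum_(i <- r | P i) c = c *+ count P r.
Proof. by rewrite big_const_seq iter_addr addr0. Qed.

Lemma big_nat_shift (V : nmodType) (F : nat -> V) k r e : (k + r <= e)%N ->
  (forall l, (l < k)%N || (k + r < l)%N -> F l = 0) ->
  \sum_(l < e.+1) F l = \sum_(i < r.+1) F (k + i)%N.
Proof.
move=> kre F0; rewrite -(big_mkord xpredT) (@big_cat_nat _ _ _ k) //=; last by lia.
rewrite big_nat big1 ?add0r => [|l lk]; last by apply: F0; lia.
rewrite (@big_cat_nat _ _ _ (k + r).+1) //=; last by lia.
rewrite [X in _ + X]big_nat [X in _ + X]big1 ?addr0 => [|l lk]; last by apply: F0; lia.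
rewrite -{1}[k]add0n big_addn -[RHS](big_mkord xpredT (fun i => F (k + i)%N)).
by rewrite subSn ?leq_addr // addKn; apply: eq_bigr => i _; rewrite addnC.
Qed.

Lemma partitions_of0 : partitions_of 0 = [:: [::]].
Proof.
apply: perm_small_eq => //; apply: uniq_perm => //; first exact: partitions_of_uniq.
move=> l; rewrite mem_partitions_of inE; case: l => //= a l.
by rewrite is_partition_cons addn_eq0 lt0n; case: (a == 0%N); rewrite ?andbF.
Qed.

Section SchurFunctions.
Variables (R : comNzRingType) (x : nat -> R).

Fixpoint hsym (N e : nat) : R :=
  if N is M.+1 then \sum_(j < e.+1) x M ^+ (e - j) * hsym M j else (e == 0)%N%:R.

(** The branching rule, in which the cells carrying the last variable form a horizontal strip. As a
    definition it applies to any alphabet in any commutative ring and fits inductions on [N];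
    [schurE] links it to tableaux. *)
Fixpoint sch (N : nat) (lam : seq nat) : R :=
  if N is M.+1 then
    \sum_(mu <- parts_upto (sumn lam) | inter mu lam)
       x M ^+ (sumn lam - sumn mu) * sch M mu
  else (lam == [::])%:R.

Lemma hsym0 N : hsym N 0 = 1.
Proof. by elim: N => //= N IH; rewrite big_ord1 expr0 mul1r. Qed.

Lemma sch_nil N : sch N [::] = 1.
Proof.
elim: N => //= N IH; rewrite big_mkcond /parts_upto /= cats0 partitions_of0.
by rewrite big_seq1 /= expr0 mul1r.
Qed.

(** Peeling the last variable off $s_\nu$ leaves a $\lambda$ below $\nu$; the local rule trades the
    common upper neighbours $\nu$ of $\lambda$ and $\mu$ for common lower neighbours $\kappa$, and
    the induction hypothesis sums over the $\lambda$ above $\kappa$. *)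
Lemma pieri N mu r : is_partition mu ->
  \sum_(nu <- partitions_of (sumn mu + r) | inter mu nu) sch N nu =
  hsym N r * sch N mu.
Proof.
elim: N mu r => [|N IH] mu r pmu.
  case: (posnP (sumn mu + r)) => [e0|e0].
    have -> : mu = [::].
      have := @size_partition_le mu pmu; have -> : sumn mu = 0%N by lia.
      by rewrite leqn0 size_eq0 => /eqP.
    have -> : r = 0%N by lia.
    by rewrite addn0 partitions_of0 big_mkcond big_seq1 /= mul1r.
  rewrite big_seq_cond big1 => [|nu /andP[/partitions_ofP[_ nue] _]] /=.
    case: eqP => [r0|_]; last by rewrite mul0r.
    by case: eqP => [mu0|_]; [move: e0; rewrite mu0 r0 | rewrite mulr0].
  by case: eqP => // nu0; move: e0; rewrite -nue nu0.
set e := (sumn mu + r)%N.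
transitivity (\sum_(lam <- parts_upto e)
   \sum_(nu <- partitions_of e | inter lam nu && inter mu nu)
     x N ^+ (e - sumn lam) * sch N lam).
  rewrite (eq_bigr (fun nu => \sum_(lam <- parts_upto (sumn nu) | inter lam nu)
       x N ^+ (sumn nu - sumn lam) * sch N lam)) //.
  rewrite (big_partitions_of_size e (inter mu) (fun k nu =>
     \sum_(lam <- parts_upto k | inter lam nu) x N ^+ (k - sumn lam) * sch N lam)).
  rewrite (exchange_big_dep xpredT) //=.
  by apply: eq_bigr => lam _; apply: eq_bigl => nu; rewrite andbC.
transitivity (\sum_(lam <- parts_upto e)
   \sum_(k <- parts_upto (sumn mu) |
         [&& inter k lam, inter k mu & (sumn lam + sumn mu <= sumn k + e)%N])
     x N ^+ (e - sumn lam) * sch N lam).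
  rewrite big_seq [RHS]big_seq; apply: eq_bigr => lam.
  by rewrite mem_parts_upto => /andP[plam _]; rewrite !sumr_const_count local_rule.
rewrite (exchange_big_dep (fun k => inter k mu)) /=; last by move=> ? ? _ /and3P[].
rewrite big_distrr /= big_seq_cond [RHS]big_seq_cond.
apply: eq_bigr => k /andP[]; rewrite mem_parts_upto => /andP[pk kmu] ikmu.
(* With $\kappa$ fixed, $\lambda$ is sorted by its size [l]; as $e = |\mu| + r$, the inequality of
   the local rule becomes $l \le |\kappa| + r$. *)
transitivity (\sum_(l < e.+1) (l <= sumn k + r)%N%:R *
    (x N ^+ (e - l) * \sum_(lam <- partitions_of l | inter k lam) sch N lam)).
  rewrite big_parts_upto; apply: eq_bigr => l _.
  rewrite !mulr_sumr big_mkcondr big_mkcond [RHS]big_mkcond big_seq [RHS]big_seq.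
  apply: eq_bigr => lam /partitions_ofP[_ <-]; rewrite ikmu /=.
  have -> : (sumn lam + sumn mu <= sumn k + e = (sumn lam <= sumn k + r))%N.
    by rewrite /e; lia.
  by case: (inter k lam); case: (sumn lam <= sumn k + r)%N; rewrite ?(mul1r, mul0r).
(* Only $l = |\kappa| + i$ with $0 \le i \le r$ survives, and the power of $x_N$ splits as
   $x_N^{r-i} x_N^{|\mu|-|\kappa|}$. *)
rewrite (@big_nat_shift _ (fun l => (l <= sumn k + r)%N%:R *
    (x N ^+ (e - l) * \sum_(lam <- partitions_of l | inter k lam) sch N lam))
    (sumn k) r); [|by rewrite /e; lia|]; last first.
  move=> l /orP[lk|lk]; last by rewrite leqNgt lk mul0r.
  rewrite big_seq_cond big1 ?mulr0 // => lam /andP[/partitions_ofP[_ lame] ik].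
  by have := inter_sumn ik; lia.
rewrite mulr_suml; apply: eq_bigr => i _.
have ir : (i <= r)%N by rewrite -ltnS.
rewrite IH // leq_add2l ir mul1r !mulrA; congr (_ * _).
rewrite [RHS]mulrAC -exprD; congr (_ ^+ _ * _).
by rewrite /e; lia.
Qed.

End SchurFunctions.

(** * Newton's identities and the Cauchy identity *)

Section Newton.
Variable R : comNzRingType.
Implicit Types (p q c t x : nat -> R) (d e : nat).

(* q 0, q 1, ... are related to p 1, p 2, ... by Newton's identities, as
   complete homogeneous symmetric functions are to power sums; p 0 is
   ignored. *)
Definition newton d p q :=
  q 0%N = 1 /\
  forall e, (e <= d)%N -> q e *+ e = \sum_(k < e) p k.+1 * q (e - k.+1)%N.

Definition conv q q' e := \sum_(j < e.+1) q (e - j)%N * q' j.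

Lemma convC q q' : conv q q' =1 conv q' q.
Proof.
move=> e; rewrite /conv (reindex_inj rev_ord_inj) /=; apply: eq_bigr => j _.
have je : (j <= e)%N by rewrite -ltnS.
by rewrite subSS subKn // mulrC.
Qed.

Lemma newton_ext d p p' q q' : p =1 p' -> q =1 q' ->
  newton d p q -> newton d p' q'.
Proof.
move=> pp qq [q0 qn]; split; first by rewrite -qq.
by move=> e ed; rewrite -qq qn //; apply: eq_bigr => k _; rewrite pp qq.
Qed.

(** In terms of generating series Newton's identities read $t\,q'(t) = p(t) q(t)$, so $p$ is a
    logarithmic derivative and adds up over products; [half] is one summand of the Leibniz rule. *)
Lemma newton_conv d p p' q q' :
  newton d p q -> newton d p' q' ->
  newton d (fun k => p k + p' k) (conv q q').
Proof.
have half p1 q1 q2 e : newton d p1 q1 -> (e <= d)%N ->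
    \sum_(j < e.+1) (q1 (e - j)%N *+ (e - j)) * q2 j =
    \sum_(k < e) p1 k.+1 * conv q1 q2 (e - k.+1).
  case=> _ nq ed; transitivity (\sum_(j < e.+1) \sum_(k < e | (k < e - j)%N)
      p1 k.+1 * (q1 (e - j - k.+1)%N * q2 j)).
    apply: eq_bigr => j _; rewrite nq; last by lia.
    rewrite mulr_suml (big_ord_widen e
      (fun k => p1 k.+1 * q1 (e - j - k.+1)%N * q2 j)); last by lia.
    by apply: eq_bigr => k _; rewrite mulrA.
  rewrite (exchange_big_dep xpredT) //=; apply: eq_bigr => k _.
  rewrite /conv mulr_sumr (big_ord_widen e.+1
    (fun j => p1 k.+1 * (q1 (e - k.+1 - j)%N * q2 j))); last by lia.
  have ke := ltn_ord k.
  by apply: eq_big => [j|j _]; [lia | rewrite subnAC].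
move=> nq nq'; case: (nq) (nq') => [q0 _] [q0' _]; split.
  by rewrite /conv big_ord1 /= q0 q0' mulr1.
move=> e ed; under [RHS]eq_bigr do rewrite mulrDl.
rewrite big_split /= -(half p q q') //.
under [X in _ = _ + X]eq_bigr do rewrite convC.
rewrite -(half p' q' q) // [X in _ = _ + X](reindex_inj rev_ord_inj) /=.
rewrite -big_split /conv -sumrMnl; apply: eq_bigr => j _ /=.
have je : (j <= e)%N by rewrite -ltnS.
rewrite subSS subKn // mulrnAl mulrnAl [q' j * _]mulrC -mulrnDr.
by rewrite subnK.
Qed.

Lemma newton_delta d : newton d (fun=> 0) (fun e => (e == 0%N)%:R).
Proof.
split=> // -[|e] _ /=; first by rewrite big_ord0.
by rewrite mul0rn big1 // => k _; rewrite mul0r.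
Qed.

Lemma newton_one d : newton d (fun=> 1) (fun=> 1).
Proof.
split=> // e _; under eq_bigr do rewrite mulr1.
by rewrite sumr_const card_ord.
Qed.

Lemma newton_scale d a p q :
  newton d p q -> newton d (fun k => a ^+ k * p k) (fun e => a ^+ e * q e).
Proof.
case=> q0 nq; split; first by rewrite q0 mulr1.
move=> e ed; rewrite -mulrnAr nq // mulr_sumr; apply: eq_bigr => k _.
by rewrite mulrACA -exprD subnKC.
Qed.

(* The degree e part of the product over i < N of \sum_j c j * t i ^+ j. *)
Fixpoint gsum c t (N e : nat) : R :=
  if N is M.+1 then \sum_(j < e.+1) (t M ^+ (e - j) * c (e - j)%N) * gsum c t M j
  else (e == 0%N)%:R.

Lemma newton_gsum d p c t N : newton d p c ->
  newton d (fun k => p k * \sum_(i < N) t i ^+ k) (gsum c t N).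
Proof.
move=> nc; elim: N => [|N IH].
  by apply: newton_ext (newton_delta d) => // k; rewrite big_ord0 mulr0.
apply: newton_ext (newton_conv (newton_scale (t N) nc) IH) => // k.
by rewrite big_ord_recr /= mulrDr addrC mulrC [X in _ + X]mulrC.
Qed.

Lemma newton_hsym d x N : newton d (fun k => \sum_(i < N) x i ^+ k) (hsym x N).
Proof.
apply: newton_ext (newton_gsum x N (newton_one d)) => [k|e].
  by rewrite mul1r.
elim: N e => //= N IH e; apply: eq_bigr => j _.
by rewrite mulr1 IH.
Qed.

(** Peeling off the last $y$ variable turns $s_\nu(y)$ into a sum over $\mu$ below $\nu$, and
    Pieri's rule in $x$ then sums $s_\nu(x)$ over $\nu$: the result is the factor $\sum_j h_j(x)
    y_M^j$. *)
Lemma cauchy_rec (x y : nat -> R) N M e :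
  \sum_(nu <- partitions_of e) sch x N nu * sch y M nu =
  gsum (hsym x N) y M e.
Proof.
elim: M e => [|M IH] e /=.
  case: e => [|e]; first by rewrite partitions_of0 big_seq1 sch_nil mul1r.
  rewrite big_seq big1 // => nu /partitions_ofP[_ nue].
  by case: eqP => [nu0|_]; [move: nue; rewrite nu0 | rewrite mulr0].
transitivity (\sum_(nu <- partitions_of e) \sum_(mu <- parts_upto e | inter mu nu)
   sch x N nu * (y M ^+ (e - sumn mu) * sch y M mu)).
  by rewrite big_seq [RHS]big_seq; apply: eq_bigr => nu /partitions_ofP[_ <-];
    rewrite mulr_sumr.
rewrite (exchange_big_dep xpredT) //= big_parts_upto; apply: eq_bigr => k _.
rewrite -IH mulr_sumr big_seq [RHS]big_seq; apply: eq_bigr => mu /partitions_ofP[pmu muk].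
have ke : (k <= e)%N by rewrite -ltnS.
rewrite -mulr_suml -[in partitions_of e](subnKC ke) -[in X in X * _]muk pieri // muk.
by rewrite mulrCA !mulrA.
Qed.

Lemma newton_cauchy d (x y : nat -> R) N M :
  newton d (fun k => (\sum_(i < N) x i ^+ k) * \sum_(j < M) y j ^+ k)
    (fun e => \sum_(nu <- partitions_of e) sch x N nu * sch y M nu).
Proof.
apply: newton_ext (newton_gsum y M (newton_hsym d x N)) => // e.
by rewrite cauchy_rec.
Qed.

Variable iota : {rmorphism rat -> R}.

Lemma mulrn_rat_inj n : (0 < n)%N -> injective (fun a : R => a *+ n).
Proof.
move=> n0 a b /= /(congr1 (fun u => iota (n%:R^-1) * u)).
rewrite -[a *+ n]mulr_natl -[b *+ n]mulr_natl -(rmorph_nat iota) !mulrA -rmorphM.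
rewrite mulVf ?pnatr_eq0 -?lt0n //. by rewrite (rmorph1 iota) !mul1r.
Qed.

(** The identity in degree [e] determines $q_e$ after division by [e]; this is why [R] receives the
    rationals through [iota]. *)
Lemma newton_uniq d p q q' : newton d p q -> newton d p q' ->
  forall e, (e <= d)%N -> q e = q' e.
Proof.
move=> [q0 nq] [q0' nq']; elim/ltn_ind=> -[|e] IH ed; first by rewrite q0 q0'.
apply: (@mulrn_rat_inj e.+1) => //=; rewrite nq // nq' //.
by apply: eq_bigr => k _; rewrite IH //; lia.
Qed.

End Newton.

(* Partitions with parts at most d, encoded by their multiplicities: part
   k.+1 occurs rho k times. *)
Notation mults d := {ffun 'I_d -> 'I_d.+1}.

Definition wt d (rho : mults d) : nat := (\sum_(k < d) k.+1 * rho k)%N.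

(* The order of the centralizer of a permutation of cycle type rho. *)
Definition zpart d (rho : mults d) : rat :=
  \prod_(k < d) ((k.+1 ^ rho k * (rho k)`!)%N%:R).

Definition ppow (R : comNzRingType) d (p : nat -> R) (rho : mults d) : R :=
  \prod_(k < d) p k.+1 ^+ rho k.

Section PowerSumExpansion.
Variables (R : comNzRingType) (iota : {rmorphism rat -> R}).
Variables (d : nat) (p : nat -> R).
Implicit Types (rho : mults d) (i k : 'I_d).

Let term (rho : mults d) : R := iota (zpart rho)^-1 * ppow p rho.

Let inc (k : 'I_d) (rho : mults d) : mults d :=
  [ffun i => inord (rho i + (i == k))].
Let dec (k : 'I_d) (rho : mults d) : mults d :=
  [ffun i => inord (rho i - (i == k))].

Let incE k rho i : (rho k < d)%N -> inc k rho i = (rho i + (i == k))%N :> nat.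
Proof.
move=> kd; rewrite ffunE inordK // ltnS; case: eqP => [->|_]; first by lia.
by rewrite addn0 -ltnS.
Qed.

Let decE k rho i : dec k rho i = (rho i - (i == k))%N :> nat.
Proof. by rewrite ffunE inordK //; have := ltn_ord (rho i); lia. Qed.

Let decK k rho : (0 < rho k)%N -> inc k (dec k rho) = rho.
Proof.
move=> k0; apply/ffunP => i; apply: val_inj; rewrite /= incE ?decE /=; last first.
  by have := ltn_ord (rho k); rewrite eqxx; lia.
by case: eqP => [->|_]; lia.
Qed.

Let incK k rho : (rho k < d)%N -> dec k (inc k rho) = rho.
Proof.
move=> kd; apply/ffunP => i; apply: val_inj; rewrite /= decE incE //.
by case: eqP => [->|_]; lia.
Qed.

Let wt_inc k rho : (rho k < d)%N -> wt (inc k rho) = (wt rho + k.+1)%N.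
Proof.
move=> kd; rewrite /wt (bigD1 k) //= [in RHS](bigD1 k) //= incE // eqxx.
rewrite mulnDr muln1 addnAC; congr (_ + _ + _)%N.
by apply: eq_bigr => i /negbTE ik; rewrite incE // ik addn0.
Qed.

Let wt_ge rho k : (rho k <= wt rho)%N.
Proof. by rewrite /wt (bigD1 k) //=; have := leq_pmull (rho k) (ltn0Sn k); lia. Qed.

Let zpart_inc k rho : (rho k < d)%N ->
  zpart (inc k rho) = (k.+1 * (rho k).+1)%:R * zpart rho.
Proof.
move=> kd; rewrite /zpart (bigD1 k) //= [in RHS](bigD1 k) //= incE // eqxx addn1.
rewrite mulrA -natrM; congr (_%:R * _); first by rewrite expnS factS mulnACA.
by apply: eq_bigr => i /negbTE ik; rewrite incE // ik addn0.
Qed.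

Let ppow_inc k rho : (rho k < d)%N -> ppow p (inc k rho) = p k.+1 * ppow p rho.
Proof.
move=> kd; rewrite /ppow (bigD1 k) //= [in RHS](bigD1 k) //= incE // eqxx addn1.
rewrite exprS mulrA; congr (_ * _).
by apply: eq_bigr => i /negbTE ik; rewrite incE // ik addn0.
Qed.

Let term_inc k rho : (rho k < d)%N ->
  term (inc k rho) *+ (k.+1 * (rho k).+1) = p k.+1 * term rho.
Proof.
move=> kd; rewrite /term zpart_inc // ppow_inc // -[LHS]mulr_natl -(rmorph_nat iota).
rewrite mulrA -rmorphM invfM mulVKf ?pnatr_eq0 ?muln_eq0 //.
by rewrite mulrCA.
Qed.

(** Multiplying a term by its weight $\sum_k (k+1)\rho_k$ and removing one part $k+1$ gives back a
    term of lower weight, because $z_\rho = (k+1)\rho_k z_{\rho'}$ when $\rho'$ is $\rho$ without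
    that part. *)
Lemma newton_ppow :
  newton d p (fun e => \sum_(rho : mults d | wt rho == e) term rho).
Proof.
split.
  rewrite (big_pred1 [ffun=> ord0]) => [|rho] /=.
    rewrite /term /zpart /ppow !big1 ?invr1 ?rmorph1 ?mulr1 // => i _; rewrite ffunE //.
  apply/eqP/eqP => [w0|->]; last by rewrite /wt big1 // => i _; rewrite ffunE muln0.
  by apply/ffunP => k; rewrite ffunE; apply: val_inj => /=; have := wt_ge rho k; lia.
move=> e ed.
transitivity (\sum_(k < d) \sum_(rho : mults d | wt rho == e) term rho *+ (k.+1 * rho k)).
  rewrite exchange_big -sumrMnl /=; apply: eq_bigr => rho /eqP <-.
  by rewrite /wt sumrMnr.
rewrite (big_ord_widen d (fun k : nat => p k.+1 *
  \sum_(rho : mults d | wt rho == (e - k.+1)%N) term rho)) // [RHS]big_mkcond /=.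
apply: eq_bigr => k _.
transitivity (\sum_(rho : mults d | (wt rho == e) && (0 < rho k)%N)
    term rho *+ (k.+1 * rho k)).
  rewrite [RHS]big_mkcondr /=; apply: eq_bigr => rho _; case: posnP => // ->.
  by rewrite muln0.
rewrite (reindex_onto (inc k) (dec k)) => [|rho /andP[_ k0]]; last exact: decK.
transitivity (\sum_(rho : mults d | (wt rho + k.+1 == e)%N) p k.+1 * term rho).
  have cond rho : (wt (inc k rho) == e) && (0 < inc k rho k)%N && (dec k (inc k rho) == rho)
      = (wt rho + k.+1 == e)%N.
    case: (ltnP (rho k) d) => kd.
      by rewrite wt_inc // incE // incK // !eqxx addn1 !andbT.
    (* At multiplicity [d] the increment leaves the range, but the weight plus [k.+1] then exceeds
       [d] and neither side holds. *)
    have wk := wt_ge rho k; case: (_ =P rho) => [/(congr1 (fun s : mults d => s k : nat))|_].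
      by rewrite decE eqxx; have := ltn_ord (inc k rho k); lia.
    by rewrite andbF; lia.
  apply: eq_big => // rho; rewrite cond => we.
  by rewrite incE ?eqxx ?addn1 ?term_inc //; have := wt_ge rho k; lia.
rewrite -mulr_sumr; case: ltnP => ke.
  by congr (_ * _); apply: eq_bigl => rho; lia.
by rewrite big_pred0 ?mulr0 // => rho; lia.
Qed.

End PowerSumExpansion.

(** * Kostka numbers and integral combinations of Schur functions *)

(** The content [m] is an arbitrary function: these numbers serve both as the multiplicities of
    $s_\lambda$ in a product of the $h_{m_i}$ and as the coefficients of monomials in
    $s_\lambda$. *)
Fixpoint kostka (m : nat -> nat) (N : nat) (lam : seq nat) : nat :=
  if N is M.+1 then
    (\sum_(mu <- parts_upto (sumn lam) | inter mu lam && (sumn lam == sumn mu + m M))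
       kostka m M mu)%N
  else (lam == [::]).

Lemma eq_kostka m m' N lam : (forall i, (i < N)%N -> m i = m' i) ->
  kostka m N lam = kostka m' N lam.
Proof.
elim: N lam => //= N IH lam mm; rewrite mm //; apply: eq_bigr => mu _.
by apply: IH => i iN; apply: mm; apply: leqW.
Qed.

(** The statistic $n(\lambda)$; it strictly decreases when a partition moves up in dominance order
    and takes the place of that order in the triangularity arguments. *)
Definition nstat (lam : seq nat) : nat := (\sum_(i < size lam) i * nth 0 lam i)%N.

Lemma nstatE lam N : (size lam <= N)%N -> nstat lam = (\sum_(i < N) i * nth 0 lam i)%N.
Proof.
move=> sN; rewrite /nstat (big_ord_widen N (fun i => i * nth 0 lam i)%N) // big_mkcond.
by apply: eq_bigr => i _; case: ltnP => // li; rewrite nth_default ?muln0.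
Qed.

(* Removing the last strip [lam / mu] of size [m M] decreases [nstat] by at
   most [M * m M], because [lam] has at most [M.+1] rows. *)
Lemma kostka_triangular m N lam : is_partition lam -> kostka m N lam != 0%N ->
  [/\ (size lam <= N)%N, (nstat lam <= \sum_(i < N) i * m i)%N &
      nstat lam = (\sum_(i < N) i * m i)%N ->
      forall i, (i < N)%N -> nth 0%N lam i = m i].
Proof.
elim: N lam => [|N IH] lam plam /=.
  by case: (lam =P [::]) => // -> _; rewrite /nstat !big_ord0.
move=> K0; have [mu [pmu il sl Kmu]] : exists mu,
    [/\ is_partition mu, inter mu lam, sumn lam = (sumn mu + m N)%N & kostka m N mu != 0%N].
  move: K0; rewrite sum_nat_seq_neq0 => /hasP[mu].
  rewrite mem_parts_upto => /andP[pmu _] /andP[/andP[il /eqP sl] K].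
  by exists mu.
have [szmu nmu eqmu] := IH mu pmu Kmu.
have szlam : (size lam <= N.+1)%N by apply: leq_trans (inter_size_le plam il) _.
have szmu' := leqW szmu.
move/interP: il => il.
have le i : (nth 0 mu i <= nth 0 lam i)%N by case/andP: (il i).
(* A cell of the strip in row [i] adds [i] to [nstat], short of the bound [N] by [N - i]; equality
   therefore puts the whole strip in row [N]. *)
have key : (nstat lam + \sum_(i < N.+1) (N - i) * (nth 0 lam i - nth 0 mu i) =
            nstat mu + N * m N)%N.
  have -> : (m N = \sum_(i < N.+1) (nth 0 lam i - nth 0 mu i))%N.
    rewrite sumnB // -(sumn_nth szlam) -(sumn_nth szmu'); lia.
  rewrite (nstatE szlam) (nstatE szmu') -big_split big_distrr -big_split /=.
  apply: eq_bigr => i _; have iN : (i <= N)%N by rewrite -ltnS.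
  have := le i; move: (nth 0%N lam i) (nth 0%N mu i) (nat_of_ord i) iN => a b j jN ba.
  by rewrite -{1}(subnKC ba) -[N in RHS](subnKC jN) mulnDr mulnDl addnA.
move: key; set D := (\sum_(i < N.+1) (N - i) * _)%N => key.
rewrite big_ord_recr /=; split=> //.
  by apply: (leq_trans (leq_addr D _)); rewrite key leq_add2r.
move=> eqn.
have [nmuE /eqP] : nstat mu = (\sum_(i < N) i * m i)%N /\ D = 0%N.
  move: eqn nmu key; move: (\sum_(i < N) _)%N D (N * m N)%N => S D' p *; lia.
rewrite /D sum_nat_eq0 => /forallP D0.
have eqm i : (i < N)%N -> nth 0%N lam i = m i.
  move=> iN; rewrite -eqmu //.
  have := D0 (Ordinal (leqW iN)); rewrite /= muln_eq0; have := le i; lia.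
move=> i; rewrite ltnS leq_eqVlt => /orP[/eqP ->|]; last exact: eqm.
move: sl; rewrite (sumn_nth szlam) (sumn_nth szmu) big_ord_recr /=.
rewrite (eq_bigr (fun i : 'I_N => nth 0%N mu i)); first by lia.
by move=> j _; rewrite eqm // eqmu.
Qed.

Lemma partition_eq_sumn mu lam : is_partition mu -> is_partition lam ->
  (forall i, nth 0 mu i <= nth 0 lam i)%N -> sumn mu = sumn lam -> mu = lam.
Proof.
move=> pmu plam le; set L := maxn (size mu) (size lam).
have [sm sl] : (size mu <= L)%N /\ (size lam <= L)%N by rewrite leq_maxl leq_maxr.
rewrite (sumn_nth sm) (sumn_nth sl) => eqs.
have /eqP : (\sum_(i < L) (nth 0 lam i - nth 0 mu i) = 0)%N by rewrite sumnB // eqs subnn.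
rewrite sum_nat_eq0 => /forallP D0; apply: partition_nth_inj => // i.
case: (ltnP i L) => iL; first by have := D0 (Ordinal iL); have := le i; rewrite /=; lia.
by rewrite !nth_default //; apply: leq_trans iL.
Qed.

Lemma is_partition_take N lam : is_partition lam -> is_partition (take N lam).
Proof.
elim: lam N => [|a lam IH] [|N] //; rewrite [take _ _]/= !is_partition_cons.
move=> /and3P[-> la /IH ->]; rewrite andbT /=; apply: leq_trans la.
by case: (lam) => // b l; case: (N).
Qed.

Lemma nth_take0 (lam : seq nat) N i : nth 0%N (take N lam) i = if (i < N)%N then nth 0%N lam i else 0%N.
Proof.
case: ltnP => iN; first by rewrite nth_take.
by rewrite nth_default // size_take_min; lia.
Qed.

(** The only filling has [i] throughout row [i]; the truncations [take N lam] are the shapes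
    occupied by its first [N] letters. *)
Lemma kostka_diag lam N : is_partition lam -> kostka (nth 0%N lam) N (take N lam) = 1%N.
Proof.
move=> plam; elim: N => [|N IH] /=; first by rewrite take0.
have pt k : is_partition (take k lam) by apply: is_partition_take.
have sz k : (size (take k lam) <= k)%N by rewrite size_take_min geq_minl.
have sumt : sumn (take N.+1 lam) = (sumn (take N lam) + nth 0%N lam N)%N.
  rewrite (sumn_nth (sz N.+1)) (sumn_nth (sz N)) big_ord_recr /= nth_take0 ltnSn.
  by congr (_ + _)%N; apply: eq_bigr => i _; rewrite !nth_take0 ltn_ord leqW.
have it : inter (take N lam) (take N.+1 lam).
  apply/interP => i; rewrite !nth_take0; have := partition_nth_anti plam (leqnSn i).
  by case: (ltnP i N) => ?; case: (ltnP i N.+1) => ?; case: (ltnP i.+1 N.+1) => ? /=; lia.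
rewrite big_mkcond (bigD1_seq (take N lam)) ?parts_upto_uniq //=; last first.
  by rewrite mem_parts_upto pt inter_sumn.
rewrite it sumt eqxx /= IH big_seq_cond big1 ?addn0 // => mu.
rewrite mem_parts_upto eqn_add2r => /andP[/andP[pmu _] nemu].
case: andP => // -[imu /eqP smu]; apply/eqP; apply: contraNT nemu => K0.
(* A contributing [mu] has at most [N] rows, so it lies inside [take N lam]; both have the same
   size. *)
have [szmu _ _] := kostka_triangular pmu K0.
apply/eqP/partition_eq_sumn => // i; case: (ltnP i N) => iN; last first.
  by rewrite nth_default //; apply: leq_trans szmu iN.
by have /interP/(_ i)/andP[_] := imu; rewrite !nth_take0 iN leqW.
Qed.


Lemma kostka_diag_size lam N : is_partition lam -> (size lam <= N)%N ->
  kostka (nth 0%N lam) N lam = 1%N.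
Proof. by move=> plam sN; have := kostka_diag N plam; rewrite take_oversize. Qed.

Section IntegralSpan.
Variables (R : comNzRingType) (x : nat -> R) (n : nat).

Let s := sch x n.
Let h := hsym x n.

Lemma pieri_partitions (F : seq nat -> nat) S r :
  h r * (\sum_(mu <- partitions_of S) s mu *+ F mu) =
  \sum_(lam <- partitions_of (S + r)) s lam *+
     (\sum_(mu <- parts_upto (sumn lam) | inter mu lam && (sumn lam == sumn mu + r)%N) F mu)%N.
Proof.
rewrite mulr_sumr; transitivity (\sum_(mu <- partitions_of S)
    \sum_(lam <- partitions_of (S + r) | inter mu lam) s lam *+ F mu).
  rewrite big_seq [RHS]big_seq; apply: eq_bigr => mu /partitions_ofP[pmu <-].
  by rewrite mulrnAr -(pieri x n r pmu) -sumrMnl.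
rewrite (exchange_big_dep xpredT) //= big_seq [RHS]big_seq.
apply: eq_bigr => lam /partitions_ofP[plam sl]; rewrite sumrMnr; congr (_ *+ _).
rewrite -big_filter -[RHS]big_filter; apply: perm_big; apply: uniq_perm.
- exact/filter_uniq/partitions_of_uniq.
- exact/filter_uniq/parts_upto_uniq.
move=> mu; rewrite !mem_filter mem_partitions_of mem_parts_upto sl eqn_add2r.
by case: (inter mu lam) (is_partition mu) => -[] //=; lia.
Qed.

Lemma hsym_prod_sch (m : nat -> nat) N :
  \prod_(i < N) h (m i) =
  \sum_(lam <- partitions_of (\sum_(i < N) m i)) s lam *+ kostka m N lam.
Proof.
elim: N => [|N IH].
  by rewrite !big_ord0 partitions_of0 big_seq1 /s sch_nil.
by rewrite !big_ord_recr /= mulrC IH pieri_partitions.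
Qed.

Definition Zspan d (f : R) := exists c : seq nat -> int,
  f = \sum_(lam <- partitions_of d) s lam *~ c lam.

Lemma Zspan0 d : Zspan d 0.
Proof. by exists (fun=> 0); rewrite big1 // => lam _; rewrite mulr0z. Qed.

Lemma ZspanD d f g : Zspan d f -> Zspan d g -> Zspan d (f + g).
Proof.
move=> [c ->] [c' ->]; exists (fun l => c l + c' l).
by rewrite -big_split /=; apply: eq_bigr => l _; rewrite mulrzDr.
Qed.

Lemma Zspan_mulrz d f z : Zspan d f -> Zspan d (f *~ z).
Proof.
move=> [c ->]; exists (fun l => c l * z).
by rewrite mulrz_suml; apply: eq_bigr => l _; rewrite mulrzA.
Qed.

Lemma ZspanB d f g : Zspan d f -> Zspan d g -> Zspan d (f - g).
Proof. by move=> Zf /(Zspan_mulrz (-1)); rewrite mulrN1z; apply: ZspanD. Qed.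

Lemma Zspan_sum d (I : eqType) (r : seq I) (P : pred I) (F : I -> R) :
  (forall i, i \in r -> P i -> Zspan d (F i)) -> Zspan d (\sum_(i <- r | P i) F i).
Proof.
move=> H; rewrite big_seq_cond; apply: big_ind => [||i /andP[]]; last exact: H.
  exact: Zspan0.
exact: ZspanD.
Qed.

Lemma Zspan_sch lam : is_partition lam -> Zspan (sumn lam) (s lam).
Proof.
move=> pl; exists (fun l => (l == lam)%:R).
rewrite (bigD1_seq lam) ?partitions_of_uniq ?mem_partitions_of ?pl ?eqxx //=.
by rewrite big1 ?addr0 ?mulr1z // => l /negbTE ->.
Qed.

Lemma Zspan_hsymM d r f : Zspan d f -> Zspan (d + r) (h r * f).
Proof.
case=> c ->; rewrite mulr_sumr; apply: Zspan_sum => mu /partitions_ofP[pmu <-] _.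
rewrite mulrzAr -pieri //; apply: Zspan_mulrz.
by apply: Zspan_sum => nu /partitions_ofP[pnu <-] _; apply: Zspan_sch.
Qed.

Lemma Zspan_hprodM d (m : nat -> nat) N f :
  Zspan d f -> Zspan (d + \sum_(i < N) m i) ((\prod_(i < N) h (m i)) * f).
Proof.
move=> Zf; elim: N => [|N IH]; first by rewrite !big_ord0 mul1r addn0.
rewrite !big_ord_recr /= addnA [X in X * f]mulrC -mulrA.
exact: Zspan_hsymM.
Qed.

(* By Pieri's rule, h_mu is s_mu plus terms s_lam with smaller [nstat]. *)
Lemma Zspan_schM d mu f :
  is_partition mu -> Zspan d f -> Zspan (d + sumn mu) (s mu * f).
Proof.
move=> pmu Zf; elim/(@ltn_ind): (nstat mu) {-2}mu (erefl (nstat mu)) pmu => k IH {}mu nmu pmu.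
have := Zspan_hprodM (nth 0%N mu) (size mu) Zf.
rewrite hsym_prod_sch -sumn_nth // (bigD1_seq mu) ?partitions_of_uniq ?mem_partitions_of ?pmu ?eqxx //=.
rewrite kostka_diag_size // mulr1n mulrDl => Zh.
rewrite -[s mu * f](addrK ((\sum_(i <- partitions_of (sumn mu) | i != mu)
   s i *+ kostka (nth 0%N mu) (size mu) i) * f)); apply: (ZspanB Zh).
rewrite mulr_suml; apply: Zspan_sum => lam /partitions_ofP[plam sl] nelam.
rewrite mulrnAl; case: (posnP (kostka (nth 0%N mu) (size mu) lam)) => [->|].
  by rewrite mulr0n; apply: Zspan0.
rewrite lt0n => K0; have [szl le eql] := kostka_triangular plam K0.
rewrite pmulrn; apply: Zspan_mulrz; rewrite -sl.
apply: (IH (nstat lam)) => //; rewrite -nmu ltn_neqAle le andbT.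
apply: contraNneq nelam => /eql eqi; apply/eqP/partition_nth_inj => // i.
case: (ltnP i (size mu)) => [|im]; first exact: eqi.
by rewrite !nth_default //; apply: leq_trans im.
Qed.

(* Newton's identity expresses p_(k+1) by p_1, ..., p_k and the h_j. *)
Lemma Zspan_psumM d k f : Zspan d f ->
  Zspan (d + k.+1) ((\sum_(i < n) x i ^+ k.+1) * f).
Proof.
elim/ltn_ind: k d f => k IH d f Zf.
have [_ /(_ k.+1 (leqnn _))] := newton_hsym k.+1 x n.
rewrite big_ord_recr subnn hsym0 mulr1 /= addrC => /esym/(canRL (addrK _)) ->.
rewrite mulrBl; apply: ZspanB.
  by rewrite mulrnAl pmulrn; apply: Zspan_mulrz; apply: Zspan_hsymM.
rewrite mulr_suml; apply: Zspan_sum => j _ _; rewrite -mulrA.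
have := IH j (ltn_ord j) _ _ (Zspan_hsymM (k - j) Zf).
by rewrite subSS -addnA addnS subnK // ltnW.
Qed.

Lemma Zspan_ppow d (rho : mults d) :
  Zspan (wt rho) (ppow (fun k => \sum_(i < n) x i ^+ k) rho).
Proof.
rewrite /wt /ppow; elim/big_rec2: _ => [|k e f _ Zf].
  exists (fun=> 1); by rewrite partitions_of0 big_seq1 mulr1z /s sch_nil.
elim: (nat_of_ord (rho k)) => [|j IH]; first by rewrite muln0 mul1r.
by rewrite exprS -mulrA mulnS -addnA addnC; apply: Zspan_psumM.
Qed.

(** This existence is what gives [LRcoef], defined by a choice operator, its meaning. *)
Lemma Zspan_prod_sch mus : all is_partition mus ->
  Zspan (sumn [seq sumn m | m <- mus]) (\prod_(m <- mus) s m).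
Proof.
elim: mus => [|mu mus IH] /=.
  by exists (fun=> 1); rewrite partitions_of0 big_nil big_seq1 mulr1z /s sch_nil.
move=> /andP[pmu /IH Z]; rewrite big_cons addnC; exact: Zspan_schM.
Qed.

End IntegralSpan.

(** * Linear independence of Schur polynomials *)

Section Coefficients.
Variables (A : comNzRingType) (n : nat).
Implicit Types (m : 'X_{1..n}) (F : {mpoly A[n]}).

(** Alphabets are indexed by all naturals; the value 0 from index [n] on is never read, as at most
    [n] variables are used. *)
Definition mvar (i : nat) : {mpoly A[n]} :=
  oapp (fun o : 'I_n => 'X_o) 0 (insub i : option 'I_n).

Lemma mvarE (o : 'I_n) : mvar o = 'X_o.
Proof. by rewrite /mvar valK. Qed.

Lemma mcoeff_XnM (o : 'I_n) j F m :
  ('X_o ^+ j * F)@_m = if (j <= m o)%N then F@_(m - U_(o) *+ j)%MM else 0.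
Proof.
rewrite mpolyXn mulrC; case: leqP => jm.
  have /submK mE : (U_(o) *+ j <= m)%MM.
    apply/mnm_lepP => i; rewrite mulmnE mnm1E; case: eqP => [<-|_]; last by rewrite mul0n.
    by rewrite mul1n.
  by rewrite -[in LHS]mE addmC mcoeffMX.
rewrite [F in F * _]mpolyE mulr_suml raddf_sum big1 //= => m' _.
rewrite -scalerAl mcoeffZ -mpolyXD mcoeffX; case: eqP => [mE|_]; last by rewrite mulr0.
by move: jm; rewrite -mE mnmDE mulmnE mnm1E eqxx mul1n ltnNge leq_addl.
Qed.

Definition lowmnm (k : nat) m := [forall i : 'I_n, (k <= i)%N ==> (m i == 0)%N].

Lemma lowmnm0 m : lowmnm 0 m = (m == 0%MM).
Proof.
apply/forallP/eqP => [H|-> i]; last by rewrite mnm0E.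
by apply/mnmP => i; have := H i; rewrite mnm0E => /eqP.
Qed.

Lemma lowmnm_full m : lowmnm n m.
Proof. by apply/forallP => i; rewrite leqNgt ltn_ord. Qed.

(** [phi] looks only at exponents below [o], so the new factor ['X_o ^+ j] just prescribes the
    exponent of variable [o]: this is the common inductive step for Schur polynomials and for
    [gsum]. *)
Lemma mcoeff_XnM_low (o : 'I_n) j F (phi : (nat -> nat) -> A) m :
  (forall f g, (forall i, (i < o)%N -> f i = g i) -> phi f = phi g) ->
  (forall m, F@_m = if lowmnm o m then phi (nth 0%N m) else 0) ->
  ('X_o ^+ j * F)@_m =
    if lowmnm o.+1 m && (m o == j) then phi (nth 0%N m) else 0.
Proof.
move=> phiE FE; rewrite mcoeff_XnM FE.
have sE i : (m - U_(o) *+ j)%MM i = (m i - if nat_of_ord o == i then j else 0)%N.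
  rewrite mnmBE mulmnE mnm1E -[RHS]/(m i - if val o == val i then j else 0)%N.
  by rewrite (inj_eq val_inj); case: eqP; rewrite ?mul1n.
case: leqP => jm; last by case: eqP => [mo|]; [move: jm; rewrite mo ltnn | rewrite andbF].
have -> : lowmnm o (m - U_(o) *+ j)%MM = lowmnm o.+1 m && (m o == j).
  apply/forallP/andP => [H|[/forallP H /eqP mo] i].
    split; last by have := H o; rewrite sE eqxx leqnn /=; lia.
    apply/forallP => i; apply/implyP => oi; have := H i.
    by rewrite sE ltnW //= (ltn_eqF oi) subn0.
  apply/implyP => oi; rewrite sE; move: oi; rewrite leq_eqVlt.
  case/orP => [/eqP/val_inj <-|oi]; first by rewrite mo eqxx subnn.
  by rewrite (ltn_eqF oi) subn0; apply: (implyP (H i)).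
case: ifP => // /andP[_ /eqP mo]; apply: phiE => i io.
have iln : (i < n)%N := ltn_trans io (ltn_ord o).
have -> : i = Ordinal iln by [].
by rewrite -!mnm_nth sE (gtn_eqF io) subn0.
Qed.

Lemma mcoeff_sch k lam m : (k <= n)%N ->
  (sch mvar k lam)@_m = if lowmnm k m then (kostka (nth 0%N m) k lam)%:R else 0.
Proof.
elim: k lam m => [|k IH] lam m kn /=.
  rewrite lowmnm0; case: (lam =P [::]) => _ /=; last by rewrite mcoeff0 if_same.
  by rewrite mcoeff1; case: eqP.
rewrite raddf_sum /=; have mk : mvar k = 'X_(Ordinal kn) := mvarE (Ordinal kn).
transitivity (\sum_(mu <- parts_upto (sumn lam) | inter mu lam)
  if lowmnm k.+1 m && (m (Ordinal kn) == sumn lam - sumn mu)%N then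
    (kostka (nth 0%N m) k mu)%:R else 0 : A).
  apply: eq_bigr => mu _; rewrite mk.
  apply: (@mcoeff_XnM_low (Ordinal kn) _ _ (fun f => (kostka f k mu)%:R)) => [f g fg|m'].
    by rewrite (eq_kostka _ fg).
  by rewrite IH // ltnW.
case: ifP => _ /=; last by rewrite big1.
rewrite -big_mkcondr natr_sum /= big_seq_cond [RHS]big_seq_cond.
apply: eq_bigl => mu; case: (boolP (mu \in _)) => //=; rewrite mem_parts_upto.
by rewrite (mnm_nth 0%N) /= => /andP[_ sm]; congr (_ && _); lia.
Qed.

Lemma mcoeff_gsum k (c : nat -> A) e m : (k <= n)%N ->
  (gsum (fun i => (c i)%:MP) mvar k e)@_m =
    if lowmnm k m then (\sum_(i < k) nth 0%N m i == e)%N%:R * \prod_(i < k) c (nth 0%N m i)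
    else 0.
Proof.
elim: k e m => [|k IH] e m kn /=.
  rewrite lowmnm0 !big_ord0 mulr1 [(0 == e)%N]eq_sym; case: (e == 0)%N => /=; last by rewrite mcoeff0 if_same.
  by rewrite mcoeff1; case: eqP.
rewrite raddf_sum /=; have mk : mvar k = 'X_(Ordinal kn) := mvarE (Ordinal kn).
transitivity (\sum_(j < e.+1)
  if lowmnm k.+1 m && (m (Ordinal kn) == e - j)%N then
    c (e - j)%N * ((\sum_(i < k) nth 0%N m i == j)%N%:R * \prod_(i < k) c (nth 0%N m i)) else 0).
  apply: eq_bigr => j _; rewrite mk.
  rewrite -mulrA (@mcoeff_XnM_low (Ordinal kn) _ _ (fun f =>
     c (e - j)%N * ((\sum_(i < k) f i == j)%N%:R * \prod_(i < k) c (f i)))) //.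
    move=> f g fg; congr (_ * ((_ == _)%:R * _)); apply: eq_bigr => i _; first exact: fg.
    by rewrite fg.
  by move=> m'; rewrite mcoeffCM IH ?(ltnW kn) //=; case: ifP; rewrite ?mulr0.
case: ifP => _ /=; last by rewrite big1.
rewrite (mnm_nth 0%N) /= ![in RHS]big_ord_recr /=; set S := (\sum_(i < k) _)%N.
set a := nth 0%N m k; case: (S + a =P e)%N => [Sae|Sae]; last first.
  rewrite /= mul0r big1 // => j _; case: eqP => // aj; case: eqP => Sj /=.
    by case: Sae; have := ltn_ord j; lia.
  by rewrite mul0r mulr0.
have Se : (S < e.+1)%N by rewrite -Sae ltnS leq_addr.
have eS : (e - S)%N = a by rewrite -Sae addKn.
rewrite (bigD1 (Ordinal Se)) //= [X in _ + X]big1 => [|j neSj].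
  by rewrite eS !eqxx !mul1r addr0 mulrC.
case: eqP => // _; case: eqP => [Sj|]; last by rewrite mul0r mulr0.
by case/eqP: neSj; apply: val_inj.
Qed.

(** The coefficient of $x^\lambda$ is 1 in $s_\lambda$, and any other $s_\mu$ containing this
    monomial has smaller [nstat], so [c mu] is already known to vanish. Partitions of [d] have at
    most [n] rows, so $x^\lambda$ exists. *)
Lemma sch_free d (c : seq nat -> A) : (d <= n)%N ->
  \sum_(lam <- partitions_of d) c lam *: sch mvar n lam = 0 ->
  forall lam, lam \in partitions_of d -> c lam = 0.
Proof.
move=> dn c0 lam; elim/(@ltn_ind): (nstat lam) {-2}lam (erefl (nstat lam)).
move=> k IH {}lam nlam lamd; have /partitions_ofP[plam sl] := lamd.
have szn mu : mu \in partitions_of d -> (size mu <= n)%N.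
  by move=> /partitions_ofP[pmu smu]; apply: leq_trans dn; rewrite -smu size_partition_le.
pose m := [multinom nth 0%N lam i | i < n].
have mE i : nth 0%N m i = nth 0%N lam i.
  case: (ltnP i n) => iln.
    by have -> : i = Ordinal iln by []; rewrite -mnm_nth mnmE.
  by rewrite !nth_default ?size_tuple //; apply: leq_trans (szn _ lamd) iln.
have := congr1 (mcoeff m) c0; rewrite mcoeff0 raddf_sum /=.
rewrite (bigD1_seq lam) ?partitions_of_uniq //= mcoeffZ mcoeff_sch // lowmnm_full.
rewrite (eq_kostka (m' := nth 0%N lam)) // kostka_diag_size ?szn // mulr1.
rewrite big_seq_cond big1 ?addr0 // => mu /andP[mud nemu]; rewrite mcoeffZ.
rewrite mcoeff_sch // lowmnm_full (eq_kostka (m' := nth 0%N lam)) //.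
case: (posnP (kostka (nth 0%N lam) n mu)) => [->|]; first by rewrite mulr0.
have /partitions_ofP[pmu smu] := mud.
rewrite lt0n => K0; have [szmu le eqmu] := kostka_triangular pmu K0.
rewrite (IH (nstat mu)) ?mul0r // -nlam ltn_neqAle (nstatE (szn _ lamd)) le andbT.
apply: contraNneq nemu => /eqmu eqi; apply/eqP/partition_nth_inj => // i.
case: (ltnP i n) => [|im]; first exact: eqi.
by rewrite !nth_default //; apply: leq_trans im; apply: szn.
Qed.

End Coefficients.

(** * Semistandard tableaux *)

Section Tableaux.
Variables (R : comNzRingType) (x : nat -> R) (N D : nat).
Notation tableau := {ffun 'I_N * 'I_D -> option 'I_N}.
Implicit Types (T : tableau) (c : 'I_N * 'I_D) (lam mu : seq nat).

(* Empty cells get the value N, larger than all entries. *)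
Definition entry T c : nat := if T c is Some a then nat_of_ord a else N.

Lemma entry_inj T T' : entry T =1 entry T' -> T = T'.
Proof.
move=> E; apply/ffunP => c; have := E c; rewrite /entry.
case: (T c) (T' c) => [a|] [b|] //.
- by move/val_inj ->.
- by move=> ab; have := ltn_ord a; rewrite ab ltnn.
by move=> ab; have := ltn_ord b; rewrite -ab ltnn.
Qed.

Lemma entry_le T c : (entry T c <= N)%N.
Proof. by rewrite /entry; case: (T c) => // a; apply: ltnW. Qed.

Lemma is_ssytP lam T : is_partition lam -> reflect
  [/\ forall i j, (entry T (i, j) < N)%N = (j < nth 0%N lam i)%N,
      forall i (j j' : 'I_D), j.+1 = j' -> (entry T (i, j) <= entry T (i, j'))%N &
      forall (i i' : 'I_N) j, i.+1 = i' -> (entry T (i, j) < N)%N ->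
        (entry T (i, j) < entry T (i', j))%N]
  (is_ssyt lam T).
Proof.
move=> plam; have noneE c : (T c == None) = ~~ (entry T c < N)%N.
  by rewrite /entry; case: (T c) => [a|]; rewrite ?ltn_ord ?ltnn.
apply: (iffP idP) => [/andP[/andP[/forallP S /forallP Hr] /forallP Hc]|[S Hr Hc]].
  have sh i j : (entry T (i, j) < N)%N = (j < nth 0%N lam i)%N.
    by have /eqP := S (i, j); rewrite noneE /=; lia.
  split=> // [i j j' jj|i i' j ii].
    have := forallP (Hr (i, j)) (i, j'); rewrite /= jj !eqxx /= /entry.
    case E: (T (i, j)) => [a|]; case E': (T (i, j')) => [b|] //.
      by move=> _; apply: ltnW.
    have := sh i j; have := sh i j'; rewrite /entry E E' ltn_ord ltnn; lia.
  have := forallP (Hc (i, j)) (i', j); rewrite /= ii !eqxx /= /entry.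
  by case: (T (i, j)) => [a|]; case: (T (i', j)) => [b|] //; rewrite ltnn.
apply/andP; split; first (apply/andP; split); apply/forallP => -[i j] /=.
- by rewrite noneE S -leqNgt.
- apply/forallP => -[i' j'] /=; apply/implyP => /andP[/eqP <- /eqP jj].
  have := Hr i _ _ jj; rewrite /entry.
  by case: (T (i, j)) => [a|]; case: (T (i, j')) => [b|].
apply/forallP => -[i' j'] /=; apply/implyP => /andP[/eqP ii /eqP <-].
have := Hc _ _ j ii; rewrite /entry.
by case: (T (i, j)) => [a|]; case: (T (i', j)) => [b|] //; rewrite ltn_ord => ->.
Qed.

Definition entries_lt k T := [forall c, (entry T c < N)%N ==> (entry T c < k)%N].

Lemma entries_ltP k T :
  reflect (forall c, (entry T c < N)%N -> (entry T c < k)%N) (entries_lt k T).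
Proof. by apply: (iffP forallP) => H c; [apply: (implyP (H c)) | apply/implyP/H]. Qed.

Definition tweight T : R := \prod_c (if T c is Some a then x a else 1).

(** Box and type of entries stay fixed while the bound [k] varies, so the induction on the number of
    letters takes place inside one type of tableaux. *)
Definition ssyt_sum k lam : R :=
  \sum_(T : tableau | is_ssyt lam T && entries_lt k T) tweight T.

Definition fits lam := (size lam <= N)%N && (nth 0%N lam 0 <= D)%N.

Lemma fits_nth lam i : is_partition lam -> fits lam -> (nth 0%N lam i <= D)%N.
Proof. by move=> pl /andP[_]; apply: leq_trans; apply: partition_nth_anti. Qed.

Lemma fits_inter mu lam : is_partition mu -> inter mu lam -> fits lam -> fits mu.
Proof.
move=> pm im /andP[sN lD]; rewrite /fits (leq_trans (inter_size pm im)) //.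
by have /interP/(_ 0%N)/andP[_ /leq_trans->] := im.
Qed.

Lemma ssyt_sum0 lam : is_partition lam -> fits lam -> ssyt_sum 0 lam = (lam == [::])%:R.
Proof.
move=> pl fl; rewrite /ssyt_sum; case: eqP => [->|ne].
  rewrite (big_pred1 [ffun=> None]) => [|T] /=.
    by rewrite /tweight big1 // => c _; rewrite ffunE.
  apply/andP/eqP => [[/is_ssytP[//|S _ _] _]|->].
    apply: entry_inj => -[i j]; have := S i j; rewrite nth_nil ltn0 => h.
    by rewrite [RHS]/entry ffunE; have := entry_le T (i, j); lia.
  have E c : entry [ffun=> None] c = N by rewrite /entry ffunE.
  split; last by apply/entries_ltP => c; rewrite E ltnn.
  by apply/is_ssytP => //; split=> [i j|i j j' _|i i' j _]; rewrite !E ?nth_nil ?ltnn.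
rewrite big_pred0 // => T; apply/negP => /andP[/is_ssytP[//|S _ _] /entries_ltP b0].
have l0 : (0 < nth 0%N lam 0)%N.
  by rewrite partition_nth_gt0 // lt0n size_eq0; apply/eqP.
have N0 : (0 < N)%N by case/andP: fl; rewrite partition_nth_gt0 // in l0; lia.
have D0 : (0 < D)%N by case/andP: fl; lia.
by have := b0 (Ordinal N0, Ordinal D0); rewrite S /= l0 => /(_ isT).
Qed.

Section Step.
Variable (k : 'I_N).

(** Erasing the letter [k] and writing it back into the free cells of [lam] undo each other on
    tableaux with entries at most [k]. *)
Let res T : tableau := [ffun c => if T c is Some a then
  (if (a < k)%N then Some a else None) else None].
Let ext lam T : tableau := [ffun c => if T c is Some a then Some a else
  if (c.2 < nth 0%N lam c.1)%N then Some k else None].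

Let entry_res T c : entry (res T) c = if (entry T c < k)%N then entry T c else N.
Proof.
rewrite /entry ffunE; case: (T c) => [a|]; first by case: ifP.
by rewrite ltnNge ltnW.
Qed.

Let entry_ext lam T c : entry (ext lam T) c =
  if (entry T c < N)%N then entry T c else if (c.2 < nth 0%N lam c.1)%N then k : nat else N.
Proof.
rewrite /entry ffunE; case: (T c) => [a|]; first by rewrite ltn_ord.
by rewrite ltnn; case: ifP.
Qed.

Let kN : (k < N)%N := ltn_ord k.

Let resK lam T : is_partition lam -> is_ssyt lam T -> entries_lt k.+1 T ->
  ext lam (res T) = T.
Proof.
move=> pl /is_ssytP[//|S _ _] /entries_ltP b; apply: entry_inj => -[i j].
rewrite entry_ext entry_res /= -S; have := b (i, j); have := entry_le T (i, j).
move: (entry T (i, j)) => e eN be; case: (ltnP e k) => ek.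
  by rewrite (ltn_trans ek kN).
by rewrite ltnn; case: ltnP => eN' /=; [have := be eN' | ]; lia.
Qed.

Let extK lam T : entries_lt k T -> res (ext lam T) = T.
Proof.
move=> /entries_ltP b; apply: entry_inj => c; rewrite entry_res entry_ext.
have := b c; have := entry_le T c.
move: (entry T c) => e eN be; case: (ltnP e N) => eN'; first by rewrite be.
by case: (c.2 < _)%N; [rewrite ltnn | rewrite ltnNge (ltnW kN)] => /=; lia.
Qed.

Let ext_ssyt mu lam T : is_partition mu -> is_partition lam -> inter mu lam ->
  is_ssyt mu T -> entries_lt k T -> is_ssyt lam (ext lam T) && entries_lt k.+1 (ext lam T).
Proof.
move=> pm pl /interP im /is_ssytP[//|S Hr Hc] /entries_ltP b; apply/andP; split; last first.
  apply/entries_ltP => c; rewrite entry_ext; have := b c.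
  case: (ltnP (entry T c) N) => h1; first by move=> /(_ isT); lia.
  by case: ifP; lia.
apply/is_ssytP => //; split=> [i j|i j j' jj|i i' j ii].
- rewrite entry_ext /= S; have imi := im i; case: (ltnP j (nth 0%N mu i)) => h1.
    by rewrite S h1 (leq_trans h1) //; case/andP: imi.
  by case: ifP; rewrite ?kN ?ltnn.
- rewrite !entry_ext /= !S; have kN' := kN.
  have b1 := b (i, j); have S1 := S i j; have H1 := Hr i _ _ jj; have S2 := S i j'.
  case: (ltnP j (nth 0%N mu i)) => h1; case: (ltnP j' (nth 0%N mu i)) => h2;
  case: (ltnP j (nth 0%N lam i)) => h3; case: (ltnP j' (nth 0%N lam i)) => h4 /=; lia.
rewrite !entry_ext /= !S; have im1 := im i; have im2 := im i'; have kN' := kN.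
have b1 := b (i, j); have S1 := S i j; have S2 := S i' j; have H1 := Hc _ _ j ii.
have b2 := b (i', j); rewrite -ii in S2 im2 *.
case: (ltnP j (nth 0%N mu i)) => h1; case: (ltnP j (nth 0%N mu i.+1)) => h2;
  case: (ltnP j (nth 0%N lam i)) => h3; case: (ltnP j (nth 0%N lam i.+1)) => h4 /=; lia.
Qed.

Let sum_ltn l : (l <= D)%N -> (\sum_(j < D) (j < l)%N = l)%N.
Proof.
move=> lD; rewrite -[RHS](card_ord l) -sum1_card (big_ord_widen D (fun=> 1%N)) //.
by rewrite [RHS]big_mkcond; apply: eq_bigr => j _; case: ltnP.
Qed.

Let tweight_ext mu lam T : is_partition mu -> is_partition lam -> inter mu lam ->
  fits lam -> is_ssyt mu T ->
  tweight (ext lam T) = x k ^+ (sumn lam - sumn mu) * tweight T.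
Proof.
move=> pm pl im fl /is_ssytP[//|S _ _].
have fm := fits_inter pm im fl; have [sl _] := andP fl; have [sm _] := andP fm.
move/interP: im => im.
pose e c := ((c.2 < nth 0%N lam c.1) - (c.2 < nth 0%N mu c.1))%N.
have -> : (sumn lam - sumn mu = \sum_c e c)%N.
  rewrite (sumn_nth sl) (sumn_nth sm) -sumnB => [|i _]; last by case/andP: (im i).
  rewrite -(pair_bigA _ (fun i j => e (i, j))) /=; apply: eq_bigr => i _.
  rewrite sumnB => [|j _]; last first.
    have := im i; case: (ltnP j (nth 0%N mu i)) => h1; case: (ltnP j (nth 0%N lam i)) => //.
    by lia.
  by rewrite !sum_ltn // fits_nth.
rewrite -prodrXr -big_split; apply: eq_bigr => -[i j] _ /=.
rewrite /e ffunE /=; have := S i j; rewrite /entry; have := im i.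
case: (T (i, j)) => [a|] imi.
  rewrite ltn_ord => /esym h; have l : (j < nth 0%N lam i)%N.
    by apply: (leq_trans (n := nth 0%N mu i)); [rewrite h | case/andP: imi].
  by rewrite h l subnn mul1r.
by rewrite ltnn => <-; rewrite subn0 mulr1; case: ifP.
Qed.

Let row_shape T lam i : is_partition lam -> is_ssyt lam T ->
  forall j j' : 'I_D, (j <= j')%N -> (entry T (i, j) <= entry T (i, j'))%N.
Proof.
move=> pl /is_ssytP[//|_ Hr _] j [j' j'D] /= jj'.
elim: j' j'D jj' => [|j' IH] j'D jj'.
  by have -> : j = Ordinal j'D by apply: val_inj => /=; lia.
move: jj'; rewrite leq_eqVlt => /orP[/eqP jj|jj].
  by have -> : j = Ordinal j'D by apply: val_inj.
by apply: leq_trans (IH (ltnW j'D) jj) (Hr i (Ordinal (ltnW j'D)) _ _).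
Qed.

Let res_shape lam T : is_partition lam -> fits lam -> is_ssyt lam T ->
  entries_lt k.+1 T ->
  exists mu, [/\ is_partition mu, inter mu lam & is_ssyt mu (res T) && entries_lt k (res T)].
Proof.
move=> pl fl ST /entries_ltP b; have row i := row_shape i pl ST.
have /is_ssytP[//|S Hr Hc] := ST; have [sN lD] := andP fl.
(* Rows increase weakly, so the entries below [k] of row [i] occupy its first [f i] cells. *)
pose f i := if insub i is Some i' then (\sum_(j < D) (entry T (i', j) < k))%N else 0%N.
have fE (i : 'I_N) : f i = (\sum_(j < D) (entry T (i, j) < k))%N by rewrite /f valK.
have fN i : (N <= i)%N -> f i = 0%N by move=> Ni; rewrite /f insubF // ltnNge Ni.
have mem_f (i : 'I_N) (j : 'I_D) : (j < f i)%N = (entry T (i, j) < k)%N.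
  rewrite fE; apply/idP/idP => [|ejk].
    apply: contraLR; rewrite -!leqNgt => kej; rewrite -[X in (_ <= X)%N](sum_ltn (ltnW (ltn_ord j))).
    apply: leq_sum => j' _; case: (ltnP j' j) => [_|jj']; first by case: (_ < _)%N.
    by rewrite ltnNge (leq_trans kej (row i _ _ jj')).
  rewrite -[X in (X <= _)%N](sum_ltn (ltn_ord j)); apply: leq_sum => j' _.
  case: (ltnP j' j.+1) => // jj'; rewrite (leq_ltn_trans _ ejk) //; exact: row.
have fl_le i : (f i <= nth 0%N lam i)%N.
  case: (ltnP i N) => iN; last by rewrite fN.
  rewrite -(sum_ltn (fits_nth i pl fl)) (fE (Ordinal iN)); apply: leq_sum => j _.
  by have := S (Ordinal iN) j; have := kN; rewrite /=; case: (ltnP _ k) => //; lia.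
(* A cell of row [i.+1] in column [f i] would stand below an entry at least [k], hence contain more
   than [k]. *)
have f_ge i : (nth 0%N lam i.+1 <= f i)%N.
  case: (ltnP i.+1 N) => iN; last by rewrite nth_default // (leq_trans sN).
  rewrite leqNgt; apply/negP => fi; have := fits_nth i.+1 pl fl => liD.
  pose j := Ordinal (leq_trans fi liD).
  have := mem_f (Ordinal (ltnW iN)) j; rewrite /= ltnn => /esym/negbT; rewrite -leqNgt => ke.
  have e1 := S (Ordinal iN) j; have e2 := S (Ordinal (ltnW iN)) j; rewrite /= in e1 e2.
  have l1 := partition_nth_anti pl (leqnSn i).
  have e1' : (entry T (Ordinal iN, j) < N)%N by rewrite e1.
  have e2' : (entry T (Ordinal (ltnW iN), j) < N)%N by rewrite e2; apply: leq_trans l1.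
  by have := Hc (Ordinal (ltnW iN)) (Ordinal iN) j erefl e2'; have := b _ e1'; lia.
have fanti i : (f i.+1 <= f i)%N := leq_trans (fl_le i.+1) (f_ge i).
have nthf := nth_mkpart fanti (fN N (leqnn N)).
have pm := mkpart_partition fanti (fN N (leqnn N)).
exists (mkpart N f); split=> //.
  by apply/interP => i; rewrite nthf f_ge fl_le.
apply/andP; split; last first.
  by apply/entries_ltP => c; rewrite entry_res; case: ifP => // _; rewrite ltnn.
apply/is_ssytP => //; split=> [i j|i j j' jj|i i' j ii].
- rewrite nthf mem_f entry_res; case: ifP => [h|_]; last by rewrite ltnn.
  exact: ltn_trans kN.
- rewrite !entry_res; have := Hr i _ _ jj; have := kN.
  by case: (ltnP (entry T (i, j)) k) => h1; case: (ltnP (entry T (i, j')) k) => h2 /=; lia.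
rewrite !entry_res; case: (ltnP (entry T (i, j)) k) => h1; last by rewrite ltnn.
move=> h2; have := Hc _ _ j ii h2.
by case: (ltnP (entry T (i', j)) k) => h3.
Qed.

Let shape_uniq mu mu' T : is_partition mu -> is_partition mu' -> fits mu -> fits mu' ->
  is_ssyt mu T -> is_ssyt mu' T -> mu = mu'.
Proof.
move=> pm pm' fm fm' /is_ssytP[//|S _ _] /is_ssytP[//|S' _ _].
apply: partition_nth_inj => // i; case: (ltnP i N) => iN; last first.
  by case/andP: fm => ? _; case/andP: fm' => ? _; rewrite !nth_default //; lia.
have H (j : 'I_D) : (j < nth 0%N mu i)%N = (j < nth 0%N mu' i)%N.
  by rewrite -(S (Ordinal iN)) -(S' (Ordinal iN)).
rewrite -(sum_ltn (fits_nth i pm fm)) -(sum_ltn (fits_nth i pm' fm')).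
by apply: eq_bigr => j _; rewrite H.
Qed.

(** Each tableau is counted under exactly one [mu], the shape of its entries below [k]. *)
Lemma ssyt_sumS lam : is_partition lam -> fits lam ->
  ssyt_sum k.+1 lam =
  \sum_(mu <- parts_upto (sumn lam) | inter mu lam)
     x k ^+ (sumn lam - sumn mu) * ssyt_sum k mu.
Proof.
move=> pl fl; apply/esym.
transitivity (\sum_(mu <- parts_upto (sumn lam) | inter mu lam)
  \sum_(T | (is_ssyt lam T && entries_lt k.+1 T) &&
            (is_ssyt mu (res T) && entries_lt k (res T))) tweight T).
  rewrite big_seq_cond [RHS]big_seq_cond; apply: eq_bigr => mu.
  rewrite mem_parts_upto => /andP[/andP[pm _] im].
  rewrite (reindex_onto (ext lam) res) => [|T /andP[/andP[S b] _]]; last exact: resK.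
  rewrite mulr_sumr; apply/esym/eq_big => [T|T].
    apply/idP/idP => [/andP[/andP[_ H] /eqP E]|/andP[S b]]; first by rewrite -E.
    by rewrite (ext_ssyt pm pl) // extK // eqxx S b.
  case/andP=> /andP[_ /andP[S _]] /eqP E; rewrite E in S.
  exact: tweight_ext.
rewrite (exchange_big_dep (fun T => is_ssyt lam T && entries_lt k.+1 T)) /=; last first.
  by move=> mu T _ /andP[].
apply: eq_bigr => T /andP[S b]; rewrite big_mkcond /=.
have [mu [pm im H]] := res_shape pl fl S b.
rewrite (bigD1_seq mu) ?parts_upto_uniq ?mem_parts_upto ?pm ?inter_sumn //=.
rewrite im S b H /= big_seq_cond big1 ?addr0 // => mu'.
rewrite mem_parts_upto => /andP[/andP[pm' _] ne].
case: ifP => // /andP[im' /andP[S' _]]; case/eqP: ne.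
case/andP: H => Sm _; apply: (shape_uniq pm' pm _ _ S' Sm); exact: fits_inter fl.
Qed.

End Step.

Lemma ssyt_sum_sch k lam : (k <= N)%N -> is_partition lam -> fits lam ->
  ssyt_sum k lam = sch x k lam.
Proof.
elim: k lam => [|k IH] lam kN pl fl; first exact: ssyt_sum0.
rewrite (ssyt_sumS (Ordinal kN)) //= big_seq_cond [RHS]big_seq_cond.
apply: eq_bigr => mu; rewrite mem_parts_upto => /andP[/andP[pm _] im].
by rewrite IH ?(ltnW kN) // (fits_inter pm im).
Qed.

End Tableaux.

Lemma schurE N lam : is_partition lam -> (size lam <= N)%N ->
  schur N lam = sch (@mvar int N) N lam.
Proof.
move=> pl sN; rewrite -(@ssyt_sum_sch _ _ N (sumn lam)) //; last first.
  by rewrite /fits sN nth_partition_le_sumn.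
apply: eq_big => [T|T _].
  rewrite (_ : entries_lt _ _) ?andbT //; apply/entries_ltP => c; exact.
by apply: eq_bigr => c _; case: (T c) => // a; rewrite mvarE.
Qed.

(** * Littlewood-Richardson coefficients and the trace *)

Section Morphisms.
Variables (R S : comNzRingType) (phi : {rmorphism R -> S}).

Lemma rmorph_sch (x : nat -> R) (z : nat -> S) N lam :
  (forall i, (i < N)%N -> phi (x i) = z i) -> phi (sch x N lam) = sch z N lam.
Proof.
elim: N lam => [|N IH] lam xz /=; first by rewrite rmorph_nat.
rewrite rmorph_sum; apply: eq_bigr => mu _.
rewrite rmorphM rmorphXn xz // IH // => i iN; exact/xz/leqW.
Qed.

Lemma rmorph_ppow (p : nat -> R) d (rho : mults d) :
  phi (ppow p rho) = ppow (phi \o p) rho.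
Proof. by rewrite rmorph_prod; apply: eq_bigr => k _; rewrite rmorphXn. Qed.

Lemma newton_rmorph d p q : newton d p q -> newton d (phi \o p) (phi \o q).
Proof.
case=> q0 nq; split; first by rewrite /= q0 rmorph1.
move=> e ed; rewrite /= -rmorphMn nq // rmorph_sum; apply: eq_bigr => k _.
by rewrite rmorphM.
Qed.

End Morphisms.

Lemma eq_ppow (R : comNzRingType) (p q : nat -> R) d (rho : mults d) :
  p =1 q -> ppow p rho = ppow q rho.
Proof. by move=> pq; apply: eq_bigr => k _; rewrite pq. Qed.

Lemma ppowM (R : comNzRingType) (p q : nat -> R) d (rho : mults d) :
  ppow (fun k => p k * q k) rho = ppow p rho * ppow q rho.
Proof. by rewrite -big_split; apply: eq_bigr => k _; rewrite exprMn. Qed.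

Definition psumf (R : comNzRingType) (x : nat -> R) N k : R := \sum_(i < N) x i ^+ k.

(** * Transport of integral expansions to other alphabets *)

Section Universal.
Variables (S : comNzRingType) (d : nat) (z : nat -> S).

Let ev : {rmorphism {mpoly int[d]} -> S} :=
  mmap (intmul 1 : {rmorphism int -> S}) (fun i : 'I_d => z i).
Let ev_mvar i : (i < d)%N -> ev (mvar int d i) = z i.
Proof. by move=> id_; rewrite -[i]/(val (Ordinal id_)) mvarE /ev /= mmapX mmap1U. Qed.

(** The coefficients are integers, so an expansion over integer polynomials in [d] variables is
    universal: evaluation at any [z] keeps it. *)
Lemma universal_expansion (f : {mpoly int[d]}) (c : seq nat -> int) :
  f = \sum_(lam <- partitions_of d) sch (mvar int d) d lam *~ c lam ->
  ev f = \sum_(lam <- partitions_of d) sch z d lam *~ c lam.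
Proof.
move=> ->; rewrite rmorph_sum; apply: eq_bigr => lam _.
by rewrite rmorphMz; congr (_ *~ _); apply: rmorph_sch => i; apply: ev_mvar.
Qed.

Lemma LRcoefP mus : all is_partition mus -> sumn [seq sumn m | m <- mus] = d ->
  \prod_(mu <- mus) sch z d mu =
  \sum_(lam <- partitions_of d) sch z d lam *~ LRcoef lam mus.
Proof.
move=> pmus smus.
have schurd mu : is_partition mu -> (sumn mu <= d)%N -> schur d mu = sch (mvar int d) d mu.
  by move=> pm sm; apply: schurE => //; apply: leq_trans (size_partition_le pm) sm.
have prodE : \prod_(mu <- mus) schur d mu = \prod_(mu <- mus) sch (mvar int d) d mu.
  rewrite big_seq [RHS]big_seq; apply: eq_bigr => mu mumus; apply: schurd.
    exact: (allP pmus).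
  rewrite -smus [X in (_ <= X)%N]sumnE big_map (big_rem mu) //= leq_addr //.
have sumE (c : seq nat -> int) :
    \sum_(lam <- partitions_of d) c lam *: schur d lam =
    \sum_(lam <- partitions_of d) sch (mvar int d) d lam *~ c lam.
  rewrite big_seq [RHS]big_seq; apply: eq_bigr => lam /partitions_ofP[pl sl].
  by rewrite schurd ?sl // -[c lam in LHS]intz scaler_int.
have ex : exists c, LR_expansion mus c.
  have [c cE] := Zspan_prod_sch (mvar int d) d pmus.
  by exists c; rewrite /LR_expansion smus prodE sumE cE smus.
have := epsilon_spec (inhabits (fun _ : seq nat => 0 : int)) _ ex.
have LRE lam : sumn lam = d -> LRcoef lam mus =
    epsilon (inhabits (fun _ : seq nat => 0 : int)) (LR_expansion mus) lam.
  by move=> sl; rewrite /LRcoef sl smus eqxx.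
(* From here on the chosen coefficients are an arbitrary [c], known only through [LR_expansion]. *)
move: (epsilon _ _) LRE => c LRE.
rewrite /LR_expansion smus prodE sumE => /universal_expansion.
rewrite rmorph_prod /= => H.
transitivity (\prod_(mu <- mus) ev (sch (mvar int d) d mu)).
  by apply: eq_bigr => mu _; apply/esym/rmorph_sch => i; apply: ev_mvar.
rewrite {}H big_seq [RHS]big_seq; apply: eq_bigr => lam /partitions_ofP[_ sl].
by rewrite LRE.
Qed.

Lemma ppow_expansion (rho : mults d) (c : seq nat -> int) :
  ppow (psumf (mvar int d) d) rho =
    \sum_(lam <- partitions_of d) sch (mvar int d) d lam *~ c lam ->
  ppow (psumf z d) rho = \sum_(lam <- partitions_of d) sch z d lam *~ c lam.
Proof.
move/universal_expansion => <-; rewrite /ev rmorph_ppow; apply: eq_ppow => k /=.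
rewrite rmorph_sum; apply: eq_bigr => i _.
by rewrite rmorphXn; congr (_ ^+ _); apply/esym/ev_mvar.
Qed.

End Universal.

Lemma partition_seqsP ks mus : mus \in partition_seqs ks ->
  all is_partition mus /\ [seq sumn m | m <- mus] = ks.
Proof.
elim: ks mus => [|k ks IH] mus; first by rewrite inE => /eqP ->.
case/allpairsP => -[p r] /= [/partitions_ofP[pp <-] /IH[pr <-] ->] /=.
by rewrite pp pr.
Qed.

Lemma prod_partition_seqs (R : comNzRingType) (F : seq nat -> R) ks :
  \prod_(k <- ks) \sum_(mu <- partitions_of k) F mu =
  \sum_(mus <- partition_seqs ks) \prod_(mu <- mus) F mu.
Proof.
elim: ks => [|k ks IH] /=; first by rewrite big_nil big_seq1 big_nil.
rewrite big_cons IH big_allpairs_dep /= mulr_suml; apply: eq_bigr => mu _.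
by rewrite mulr_sumr; apply: eq_bigr => mus _; rewrite big_cons.
Qed.

(** * Multiplicity functions as partitions *)

Section MultsPartition.
Variable d : nat.
Implicit Types rho : mults d.

Definition mults_part rho : seq nat :=
  sort geq (flatten [seq nseq (rho k) k.+1 | k <- enum 'I_d]).

Lemma mults_part_wt rho : mults_part rho \in partitions_of (wt rho).
Proof.
have pe := permEl (perm_sort geq (flatten [seq nseq (rho k) k.+1 | k <- enum 'I_d])).
rewrite mem_partitions_of /is_partition sort_sorted /=; last by move=> a b; apply: leq_total.
rewrite (perm_all _ pe) (perm_sumn pe); apply/andP; split.
  by apply/allP => i /flatten_mapP[k _]; rewrite mem_nseq => /andP[_ /eqP ->].
rewrite sumn_flatten -map_comp sumnE big_map big_enum /wt; apply/eqP/eq_bigr => k _ /=.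
by rewrite sumn_nseq.
Qed.

Lemma mults_part_inj : injective mults_part.
Proof.
have cnt rho (k : 'I_d) : count_mem k.+1 (mults_part rho) = rho k.
  rewrite (permP (permEl (perm_sort _ _))) count_flatten -map_comp sumnE big_map big_enum /=.
  rewrite (bigD1 k) //= big1 ?addn0 => [|i ik]; rewrite count_nseq /=.
    by rewrite eqxx mul1n.
  by rewrite eqSS (inj_eq val_inj) (negbTE ik).
by move=> r1 r2 E; apply/ffunP => k; apply: val_inj => /=; rewrite -!cnt E.
Qed.

(** Multiplicities can be read off the partition, so distinct functions give distinct partitions.
    Equality of the two counts then follows from the rank argument of [trace_conj]. *)
Lemma card_mults_wt e : (#|[pred rho : mults d | wt rho == e]| <= size (partitions_of e))%N.
Proof.
rewrite cardE -(size_map mults_part); apply: uniq_leq_size.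
  by rewrite (map_inj_uniq mults_part_inj) enum_uniq.
by move=> l /mapP[rho]; rewrite mem_enum inE => /eqP <- ->; apply: mults_part_wt.
Qed.

End MultsPartition.

(** When the product is expanded, [rho k] is the exponent chosen in the factor of $p_{k+1}$. *)
Lemma lhs_truncE n d :
  lhs_trunc n d = \sum_(rho : mults d) ppow (psumf (mvar int n) n) rho.
Proof.
rewrite /lhs_trunc big_add1 /= big_mkord -(bigA_distr_bigA (fun (k : 'I_d) (j : 'I_d.+1) =>
  psumf (mvar int n) n k.+1 ^+ j)).
apply: eq_bigr => k _; rewrite big_mkord; apply: eq_bigr => j _; congr (_ ^+ _).
by apply: eq_bigr => i _; rewrite mvarE.
Qed.

Lemma ppow_dhomog n d (rho : mults d) :
  ppow (psumf (mvar int n) n) rho \is (wt rho).-homog.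
Proof.
rewrite /ppow /wt; elim/big_rec2: _ => [|k e f _ he]; first exact: dhomog1.
apply: dhomogM => //; apply: dhomogMn; apply: rpred_sum => i _.
by rewrite mvarE mpolyXn dhomogX /= mdegMn mdeg1 mul1n.
Qed.

(* From [B^T Z B = 1] with at least as many columns as rows, [B] is square
   and [B B^T Z = 1]. *)
Lemma trace_conj (F : fieldType) r l (B : 'M[F]_(r, l)) (Z U : 'rV[F]_r) : (r <= l)%N ->
  B^T *m diag_mx Z *m B = 1%:M ->
  \tr (B^T *m diag_mx (\row_i (Z 0 i * U 0 i)) *m B) = \sum_i U 0 i.
Proof.
move=> rl BZB; have lr : (l <= r)%N.
  have := mxrankM_maxr (B^T *m diag_mx Z) B; rewrite BZB mxrank1 => /leq_trans; apply.
  exact: rank_leq_row.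
have erl : r = l by apply/eqP; rewrite eqn_leq rl lr.
subst l; have BBZ := mulmx1C BZB.
have -> : diag_mx (\row_i (Z 0 i * U 0 i)) = diag_mx Z *m diag_mx U.
  by rewrite mulmx_diag.
by rewrite mxtrace_mulC !mulmxA -[X in \tr (X *m _)]mulmxA BBZ mul1mx mxtrace_diag.
Qed.

(* The x_i are variables over the ring of polynomials in the y_i. *)
Section TwoAlphabets.
Variable d : nat.
Notation RY := {mpoly rat[d]}.
Notation RX := {mpoly RY[d]}.

Definition xvar : nat -> RX := mvar RY d.
Definition yvar : nat -> RX := fun i => (mvar rat d i)%:MP.
Definition const_xy : {rmorphism rat -> RX} := (@mpolyC d RY \o @mpolyC d rat).

(** Linear independence is used twice: over the ring of polynomials in $y$, then over the
    rationals. *)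
Lemma sch_sch_free (a : seq nat -> seq nat -> rat) :
  \sum_(lam <- partitions_of d) \sum_(mu <- partitions_of d)
     const_xy (a lam mu) * (sch xvar d lam * sch yvar d mu) = 0 ->
  forall lam mu, lam \in partitions_of d -> mu \in partitions_of d -> a lam mu = 0.
Proof.
move=> a0; have YE mu : sch yvar d mu = (sch (mvar rat d) d mu)%:MP.
  by apply/esym; apply: (rmorph_sch (phi := @mpolyC d RY : {rmorphism RY -> RX})).
have a0' : \sum_(lam <- partitions_of d)
    (\sum_(mu <- partitions_of d) a lam mu *: sch (mvar rat d) d mu) *: sch xvar d lam = 0.
  rewrite -[RHS]a0; apply: eq_bigr => lam _; rewrite scaler_suml.
  apply: eq_bigr => mu _; rewrite YE -!mul_mpolyC rmorphM /= -mulrA.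
  by rewrite [sch xvar d lam * _]mulrC.
move=> lam mu ld md; have := sch_free (leqnn d) a0' ld.
by move/(sch_free (leqnn d)); apply.
Qed.

End TwoAlphabets.

(** * Bilinear forms in two alphabets and their matrices *)

Section BilinearForms.
Variables (d : nat) (RX : comNzRingType) (iota : {rmorphism rat -> RX}) (X Y : nat -> RX).
Hypothesis sch_free2 : forall a : seq nat -> seq nat -> rat,
  \sum_(lam <- partitions_of d) \sum_(mu <- partitions_of d)
     iota (a lam mu) * (sch X d lam * sch Y d mu) = 0 ->
  forall lam mu, lam \in partitions_of d -> mu \in partitions_of d -> a lam mu = 0.

(** For vectors $f_i$ with coordinates [b i] in the Schur basis this is $\sum_i w_i f_i(x) f_i(y)$,
    and [gram] is its matrix; for the products $s_{\boldsymbol\mu}$ with unit weights the diagonal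
    of [gram] holds the sums of squared Littlewood-Richardson coefficients. *)
Definition quad (I : Type) (r : seq I) (P : pred I) (w : I -> rat)
    (b : I -> seq nat -> int) : RX :=
  \sum_(i <- r | P i) iota (w i) *
    ((\sum_(lam <- partitions_of d) sch X d lam *~ b i lam) *
     (\sum_(lam <- partitions_of d) sch Y d lam *~ b i lam)).

Definition gram (I : Type) (r : seq I) (P : pred I) (w : I -> rat)
    (b : I -> seq nat -> int) lam mu : rat :=
  \sum_(i <- r | P i) w i * ((b i lam)%:~R * (b i mu)%:~R).

Lemma quadE I r P w b : @quad I r P w b =
  \sum_(lam <- partitions_of d) \sum_(mu <- partitions_of d)
     iota (gram r P w b lam mu) * (sch X d lam * sch Y d mu).
Proof.
rewrite /quad /gram.
transitivity (\sum_(i <- r | P i) \sum_(lam <- partitions_of d) \sum_(mu <- partitions_of d)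
  iota (w i * ((b i lam)%:~R * (b i mu)%:~R)) * (sch X d lam * sch Y d mu)).
  apply: eq_bigr => i _; rewrite mulr_suml mulr_sumr; apply: eq_bigr => lam _.
  rewrite !mulr_sumr; apply: eq_bigr => mu _.
  rewrite -[_ *~ b i lam]mulrzl -[_ *~ b i mu]mulrzl mulrACA.
  by rewrite !rmorphM !rmorph_int [LHS]mulrA.
rewrite exchange_big; apply: eq_bigr => lam _ /=.
rewrite exchange_big; apply: eq_bigr => mu _ /=.
by rewrite rmorph_sum mulr_suml.
Qed.

Lemma quad_inj I J r P w b r' P' w' b' :
  @quad I r P w b = @quad J r' P' w' b' ->
  forall lam mu, lam \in partitions_of d -> mu \in partitions_of d ->
    gram r P w b lam mu = gram r' P' w' b' lam mu.
Proof.
rewrite !quadE => E lam mu ld md; apply/eqP; rewrite -subr_eq0; apply/eqP.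
apply: (sch_free2 (a := fun lam mu => gram r P w b lam mu - gram r' P' w' b' lam mu)) => //.
apply/eqP; move/eqP: E; rewrite -subr_eq0 -sumrB; congr (_ == _).
apply: eq_bigr => l _; rewrite -sumrB; apply: eq_bigr => l' _.
by rewrite rmorphB mulrBl.
Qed.

Definition cauchy_kernel e : RX :=
  \sum_(nu <- partitions_of e) sch X d nu * sch Y d nu.

Let newton_kernel : newton d (fun k => psumf X d k * psumf Y d k) cauchy_kernel.
Proof. exact: newton_cauchy. Qed.

Section Expansion.
Variable b : mults d -> seq nat -> int.
Hypothesis bE : forall rho : mults d, wt rho = d ->
  ppow (psumf (mvar int d) d) rho =
  \sum_(lam <- partitions_of d) sch (mvar int d) d lam *~ b rho lam.

(** Both sides are the matrix of the Cauchy kernel of degree [d], written with power sums on the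
    left and with Schur functions on the right. *)
Lemma gram_ppow lam mu : lam \in partitions_of d -> mu \in partitions_of d ->
  gram (index_enum (mults d)) [pred rho | wt rho == d] (fun rho => (zpart rho)^-1) b lam mu
  = (lam == mu)%:R.
Proof.
move=> ld md; transitivity
    (gram (partitions_of d) xpredT (fun=> 1) (fun nu lam => (lam == nu)%:Z) lam mu).
  apply: quad_inj => //.
  transitivity (\sum_(rho : mults d | wt rho == d) iota (zpart rho)^-1 *
      ppow (fun k => psumf X d k * psumf Y d k) rho).
    apply: eq_bigr => rho /eqP wd.
    by rewrite ppowM !(ppow_expansion _ (bE wd)).
  rewrite -(newton_uniq iota newton_kernel (newton_ppow iota _ _) (leqnn d)).
  rewrite /cauchy_kernel /quad big_seq [RHS]big_seq; apply: eq_bigr => nu nud.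
  have one (Z : nat -> RX) :
      \sum_(lam <- partitions_of d) sch Z d lam *~ (lam == nu)%:Z = sch Z d nu.
    rewrite (bigD1_seq nu) ?partitions_of_uniq //= eqxx mulr1z big1 ?addr0 //.
    by move=> l /negbTE ->.
  by rewrite !one rmorph1 mul1r.
rewrite /gram (bigD1_seq lam) ?partitions_of_uniq //= eqxx big1 => [|nu].
  by rewrite !mul1r addr0 eq_sym; case: eqP.
by rewrite eq_sym => /negbTE ->; rewrite mul0r mulr0.
Qed.

Lemma gram_LR n (m : 'X_{1..n}) lam mu : mdeg m = d ->
  lam \in partitions_of d -> mu \in partitions_of d ->
  gram (partition_seqs [seq m i | i <- enum 'I_n]) xpredT (fun=> 1)
    (fun mus lam => LRcoef lam mus) lam mu =
  gram (index_enum (mults d)) [pred rho | wt rho == d]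
    (fun rho => (zpart rho)^-1 * ((ppow (psumf (mvar int n) n) rho)@_m)%:~R) b lam mu.
Proof.
move=> md lamd mud; apply: quad_inj => //.
pose iotan : {rmorphism rat -> {mpoly RX[n]}} := (@mpolyC n RX \o iota).
pose t : nat -> {mpoly RX[n]} := mvar RX n.
(* In the ring of polynomials in $t$ over [RX], the product of one kernel per variable and the power
   sum expansion both solve Newton's identities for $p_k(x) p_k(y) p_k(t)$, so their parts of degree
   [d] agree. *)
have nk := newton_gsum t n (newton_rmorph (@mpolyC n RX) newton_kernel).
have /(congr1 (mcoeff m)) :=
  newton_uniq iotan nk (newton_ppow iotan _ _) (leqnn d).
rewrite mcoeff_gsum // lowmnm_full.
have -> : (\sum_(i < n) nth 0%N m i = d)%N.
  by rewrite -md mdegE; apply: eq_bigr => i _; rewrite -mnm_nth.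
rewrite eqxx mul1r raddf_sum /= => H.
transitivity (\prod_(i < n) cauchy_kernel (nth 0%N m i)); last first.
  rewrite H; apply: eq_bigr => rho /eqP wd.
  rewrite (ppowM (fun k => (psumf X d k * psumf Y d k)%:MP)).
  rewrite -(rmorph_ppow (@mpolyC n RX : {rmorphism RX -> {mpoly RX[n]}})
    (fun k => psumf X d k * psumf Y d k)) ppowM !(ppow_expansion _ (bE wd)).
  (* The coefficient of $t^m$ in $p_\rho(t)$ is an integer, independent of [RX]. *)
  have -> : ppow (fun k => \sum_(i < n) t i ^+ k) rho =
      map_mpoly (intmul 1 : {rmorphism int -> RX}) (ppow (psumf (mvar int n) n) rho).
    rewrite rmorph_ppow; apply: eq_ppow => k /=; rewrite rmorph_sum; apply: eq_bigr => i _.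
    by rewrite rmorphXn /t !mvarE /= map_mpolyX.
  rewrite !mcoeffCM mcoeff_map_mpoly /= rmorphM rmorph_int -[RHS]mulrA.
  by congr (_ * _); rewrite mulrC.
transitivity (\prod_(k <- [seq m i | i <- enum 'I_n]) cauchy_kernel k); last first.
  by rewrite big_map big_enum; apply: eq_bigr => i _; rewrite -mnm_nth.
rewrite prod_partition_seqs /quad big_seq [RHS]big_seq; apply: eq_bigr => mus musP.
have [pmus smus] := partition_seqsP musP.
have sd : sumn [seq sumn mu | mu <- mus] = d.
  by rewrite smus sumnE big_map big_enum -md mdegE.
by rewrite -!LRcoefP // rmorph1 mul1r big_split.
Qed.

End Expansion.

Lemma sum_gram_LR n (m : 'X_{1..n}) : mdeg m = d ->
  \sum_(lam <- partitions_of d)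
    gram (partition_seqs [seq m i | i <- enum 'I_n]) xpredT (fun=> 1)
      (fun mus lam => LRcoef lam mus) lam lam =
  \sum_(rho : mults d | wt rho == d) ((ppow (psumf (mvar int n) n) rho)@_m)%:~R.
Proof.
move=> md; have exB (rho : mults d) : exists c : seq nat -> int, wt rho = d ->
    ppow (psumf (mvar int d) d) rho =
    \sum_(lam <- partitions_of d) sch (mvar int d) d lam *~ c lam.
  (* Away from weight [d] the condition is void and any coordinates do, which makes [b] total. *)
  case: (wt rho =P d) => [wd|]; last by exists (fun=> 0).
  by have [c cE] := Zspan_ppow (mvar int d) d rho; exists c => _; rewrite wd in cE.
have [b bE] := fin_all_exists exB.
set ps := partitions_of d; set l := size ps.
pose W := [pred rho : mults d | wt rho == d]; pose lam (j : 'I_l) := nth [::] ps j.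
have lamP j : lam j \in ps by apply: mem_nth.
have reidx (F : mults d -> rat) :
    \sum_(rho : mults d | wt rho == d) F rho = \sum_(i < #|W|) F (enum_val i).
  by rewrite -big_enum_val; apply: eq_bigl => rho; rewrite inE.
pose B : 'M[rat]_(#|W|, l) := \matrix_(i, j) (b (enum_val i) (lam j))%:~R.
pose Z : 'rV[rat]_#|W| := \row_i (zpart (enum_val i))^-1.
pose U : 'rV[rat]_#|W| := \row_i ((ppow (psumf (mvar int n) n) (enum_val i : mults d))@_m)%:~R.
have BE (V : 'rV[rat]_#|W|) (w : mults d -> rat) j j' : (forall i, V 0 i = w (enum_val i)) ->
    (B^T *m diag_mx V *m B) j j' = gram (index_enum (mults d)) W w b (lam j) (lam j').
  move=> Vw; rewrite mul_mx_diag mxE /gram reidx.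
  by apply: eq_bigr => i _; rewrite !mxE Vw mulrAC mulrC.
transitivity (\tr (B^T *m diag_mx (\row_i (Z 0 i * U 0 i)) *m B)).
  rewrite (big_nth [::]) big_mkord; apply: eq_bigr => j _.
  rewrite (BE _ (fun rho => (zpart rho)^-1 * ((ppow (psumf (mvar int n) n) rho)@_m)%:~R)).
    exact: (gram_LR bE md (lamP j) (lamP j)).
  by move=> i; rewrite !mxE.
rewrite trace_conj ?card_mults_wt //.
  by rewrite reidx; apply: eq_bigr => i _; rewrite mxE.
apply/matrixP => j j'; rewrite (BE _ (fun rho => (zpart rho)^-1)) => [|i]; last by rewrite mxE.
by rewrite (gram_ppow bE) // mxE nth_uniq ?partitions_of_uniq.
Qed.

End BilinearForms.

(* Coefficient of the monomial t^m (m supported on the first n variables)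
   on both sides of the identity. *)
Theorem theorem1 (n : nat) (m : 'X_{1..n}) :
  ((lhs_trunc n (mdeg m))@_m =
   \sum_(lam <- partitions_of (mdeg m))
     \sum_(mus <- partition_seqs [seq m i | i <- enum 'I_n])
       (LRcoef lam mus) ^+ 2)%R.
Proof.
(* The factors $1/z_\rho$ force the computation into the rationals. *)
apply: (@intr_inj rat).
transitivity (\sum_(rho : mults (mdeg m) | wt rho == mdeg m)
    ((ppow (psumf (mvar int n) n) rho)@_m)%:~R : rat).
  rewrite lhs_truncE raddf_sum /= rmorph_sum [RHS]big_mkcond; apply: eq_bigr => rho _.
  (* The truncated product also contains $p_\rho$ of weight other than $|m|$; being homogeneous,
     they do not contain $t^m$. *)
  case: eqP => [//|/eqP wd]; rewrite (dhomog_nemf_coeff (ppow_dhomog n rho)) //.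
  by rewrite eq_sym.
rewrite -(sum_gram_LR (@sch_sch_free (mdeg m))) // rmorph_sum; apply: eq_bigr => lam _.
rewrite rmorph_sum; apply: eq_bigr => mus _.
by rewrite mul1r -intrM.
Qed.
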